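(* Let $\nu,\mu,\gamma>0$, suppose $1<p<2$, and let $U_{\mathrm{NI}}(x,t)=e^{i\omega t}W_{\mathrm{NI}}(x)$, with $\omega>0$ and $W_{\mathrm{NI}}\in\mathcal A_p$, be a standing wave solution of the non-integrable NLS equation $iU_t+\nu U_{xx}+\gamma|U|^{2p}U=0$ on $\mathbb R$ which is (orbitally) stable in the following sense: for every $\epsilon>0$ there exists $\delta(\epsilon)>0$ such that if $U_0\in H^1(\mathbb R)$ satisfies $\|U_0-W_{\mathrm{NI}}\|_{H^1(\mathbb R)}\le\delta(\epsilon)$, then the maximal solution $U$ with initial datum $U_0$ satisfies $$\sup_{t>0}\inf_{\theta\in\mathbb R}\inf_{y\in\mathbb R}\|U(\cdot,t)-e^{i\theta}W_{\mathrm{NI}}(\cdot-y)\|_{H^1(\mathbb R)}\le\epsilon .$$ Given $0<\varepsilon<1$, let $u_0,U_0\in H^1(\mathbb R)$ be initial data for the integrable NLS equation $iu_t+\nu u_{xx}+\mu|u|^2u=0$ and for the non-integrable NLS equation $iU_t+\nu U_{xx}+\gamma|U|^{2p}U=0$, respectively, satisfying $$\|U_0-W_{\mathrm{NI}}\|_{H^1(\mathbb R)}\le\delta(\varepsilon),\qquad \|u_0\|_{H^1(\mathbb R)}\le c_0\varepsilon,\qquad \|u_0-U_0\|_{H^1(\mathbb R)}\le c_1\varepsilon$$ for some constants $c_0,c_1>0$, with $\delta(\varepsilon)$ as in the stability property above. Then $\|u_0-W_{\mathrm{NI}}\|_{H^1(\mathbb R)}\le c_1\varepsilon+\delta(\varepsilon)=:\widehat\delta(\varepsilon)$,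 and for arbitrary $0<T_f<\infty$ there exists a constant $\widehat K(T_f)>0$ such that the solution $u$ of the integrable equation with initial datum $u_0$ satisfies $$\sup_{t\in[0,T_f]}\inf_{\theta\in\mathbb R}\inf_{y\in\mathbb R}\|u(\cdot,t)-e^{i\theta}W_{\mathrm{NI}}(\cdot-y)\|_{H^1(\mathbb R)}\le\widehat K\varepsilon .$$
   Context: $\mathcal A_p$ is the set of standing wave profiles: $\mathcal A_p=\{W\in H^1(\mathbb R): W\ne0,\ -\nu W''+\omega W-\gamma|W|^{2p}W=0\}$, so that $e^{i\omega t}W(x)$ solves $iU_t+\nu U_{xx}+\gamma|U|^{2p}U=0$. Since $1<p<2$, all $H^1(\mathbb R)$ initial data give rise to global $H^1(\mathbb R)$ solutions for both equations, bounded uniformly in time by a constant multiple of the $H^1$ norm of the data (known well-posedness theory). The constant $\widehat K$ does not depend on $\varepsilon$ (it may depend on $T_f$, $c_0$, $c_1$ and the parameters of the equations). *)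

(* Defs.v *)
From HB Require Import structures.
From mathcomp Require Import all_boot all_order all_algebra.
From mathcomp Require Import complex.
From mathcomp Require Import all_classical all_reals all_analysis.

Set Implicit Arguments.
Unset Strict Implicit.
Unset Printing Implicit Defensive.

Import Order.TTheory GRing.Theory Num.Theory.
Import numFieldNormedType.Exports.

Local Open Scope classical_set_scope.
Local Open Scope ring_scope.
Local Open Scope complex_scope.

Definition modc (R : realType) (z : R[i]) : R := ComplexField.Normc.normc z.

Definition expi (R : realType) (theta : R) : R[i] := cos theta +i* sin theta.

Definition cintegral (R : realType) (f : R -> R[i]) : R[i] :=
  (\int[lebesgue_measure]_x complex.Re (f x))
    +i* (\int[lebesgue_measure]_x complex.Im (f x)).

(** * The Sobolev space H^1(R) of complex-valued functions

    Elements of H^1(R) are represented by Borel functions; functions equal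
    almost everywhere represent the same element. *)

Definition L2 (R : realType) (f : R -> R[i]) : Prop :=
  [/\ measurable_fun [set: R] (fun x => complex.Re (f x)),
      measurable_fun [set: R] (fun x => complex.Im (f x)) &
      (\int[lebesgue_measure]_x ((modc (f x)) ^+ 2)%:E < +oo)%E].

Definition test_function (R : realType) (phi : R -> R) : Prop :=
  [/\ forall x, derivable phi x 1,
      continuous (derive1 phi) &
      exists M : R, forall x, M < `|x| -> phi x = 0].

Definition weak_derivative (R : realType) (f g : R -> R[i]) : Prop :=
  forall phi : R -> R, test_function phi ->
    cintegral (fun x => f x * (derive1 phi x)%:C)
    = - cintegral (fun x => g x * (phi x)%:C).

Definition H1 (R : realType) (f : R -> R[i]) : Prop :=
  L2 f /\ exists g, L2 g /\ weak_derivative f g.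

(** A representative of the weak derivative, which is unique up to equality
    almost everywhere; junk value 0 outside H^1(R). *)
Definition wderiv (R : realType) (f : R -> R[i]) : R -> R[i] :=
  xget (fun=> 0) [set g | L2 g /\ weak_derivative f g].

Definition H1norm (R : realType) (f : R -> R[i]) : R :=
  Num.sqrt (\int[lebesgue_measure]_x ((modc (f x)) ^+ 2)
            + \int[lebesgue_measure]_x ((modc (wderiv f x)) ^+ 2)).

Definition H1dist (R : realType) (f g : R -> R[i]) : R :=
  H1norm (fun x => f x - g x).

(** The inner product of L^2(R) regarded as a real Hilbert space. *)
Definition L2inner (R : realType) (f g : R -> R[i]) : R :=
  complex.Re (cintegral (fun x => f x * (g x)^*)).

(** * Nonlinear Schrödinger equations *)

Definition cubic_nonlinearity (R : realType) (mu : R) (z : R[i]) : R[i] :=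
  (mu * (modc z) ^+ 2)%:C * z.

Definition power_nonlinearity (R : realType) (gamma p : R) (z : R[i]) : R[i] :=
  (gamma * (modc z) `^ (2 * p))%:C * z.

(** [nls_solution nu N u0 u]: u is a (global) H^1-solution of
    i u_t + nu u_xx + N(u) = 0 on R x [0, +oo) with u(0) = u0, i.e. u belongs to
    C([0, +oo); H^1(R)) and the equation holds in H^{-1}(R) for t > 0.
    The latter is tested against all complex phi in H^1(R) with the real inner
    product, after moving one space derivative of u_xx onto phi; replacing phi
    by 'i phi recovers the imaginary part.  Values at t < 0 are irrelevant. *)
Definition nls_solution (R : realType) (nu : R) (N : R[i] -> R[i])
    (u0 : R -> R[i]) (u : R -> R -> R[i]) : Prop :=
  [/\ forall t : R, 0 <= t -> H1 (u t),
      {ae lebesgue_measure, forall x, u 0 x = u0 x},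
      forall t : R, 0 <= t ->
        H1dist (u s) (u t) @[s --> within `[0, +oo[ (nbhs t)] --> (0 : R) &
      forall t : R, 0 < t -> forall phi : R -> R[i], H1 phi ->
        is_derive t (1 : R) (fun s : R => L2inner (fun x => 'i * u s x) phi)
          (nu * L2inner (wderiv (u t)) (wderiv phi)
           - L2inner (fun x => N (u t x)) phi)].

(** The set A_p of profiles W of standing waves exp(i omega t) W(x).  The
    equation is understood in the sense of distributions:
    nu W'' = omega W - gamma |W|^{2p} W. *)
Definition standing_wave_profile (R : realType) (nu gamma p omega : R)
    (W : R -> R[i]) : Prop :=
  [/\ H1 W,
      ~ {ae lebesgue_measure, forall x, W x = 0} &
      weak_derivative (fun x => nu%:C * wderiv W x)
        (fun x => omega%:C * W x - power_nonlinearity gamma p (W x))].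

Definition orbit_dist (R : realType) (W v : R -> R[i]) : \bar R :=
  ereal_inf [set ereal_inf
    [set (H1dist v (fun x => expi theta * W (x - y)))%:E | y in [set: R]]
    | theta in [set: R]].

(** Orbital stability of W with the explicit modulus [delta].  "The maximal
    solution with datum U0 satisfies ..." is read as a definite description: for
    1 < p < 2 that solution is unique and global, so it is the solution on
    [0, +oo) with datum U0. *)
Definition orbitally_stable (R : realType) (nu gamma p : R) (W : R -> R[i])
    (delta : R -> R) : Prop :=
  forall eps : R, 0 < eps ->
    0 < delta eps /\
    forall U0 : R -> R[i], H1 U0 -> H1dist U0 W <= delta eps ->
      exists U, nls_solution nu (power_nonlinearity gamma p) U0 U /\
        (ereal_sup [set orbit_dist W (U t) | t in [set t : R | (0 < t)%R]] <= eps%:E)%E.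

(* Main.v *)
From HB Require Import structures.
Require Import Defs.
From mathcomp Require Import all_boot all_order all_algebra.
From mathcomp Require Import complex ring lra.
From mathcomp Require Import all_classical all_reals all_analysis.
From mathcomp Require Import measurable_realfun lebesgue_integral_differentiation.
Import Order.TTheory GRing.Theory Num.Theory.
Import numFieldNormedType.Exports.
Local Open Scope classical_set_scope.
Local Open Scope ring_scope.

(** Two facts suffice.

    The profile [W] is itself small.  At time [t -> 0+] stability puts some
    [exp(i theta) W(. - y)] within [eps] of the solution issued from [U0],
    whose norm tends to that of [U0], at most [(c0 + c1) eps]; phase and
    translation preserve the [H^1] norm, hence [|W| <= (1 + c0 + c1) eps].

    The cubic solution stays small for all times: mass and energy are conserved
    and [int |u|^4 <= 4 |u|^3 |u_x|] makes the energy coercive, so that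
    [|u(t)|_{H^1} <= C eps].  Then [u(t)] is within [|u(t)| + |W|] of [W].

    Energy conservation is obtained at [H^1] regularity by replacing [|u_x|^2]
    by [|D_h u|^2], where [D_h] is the difference quotient of step [h]: the
    equation may then be tested against the resulting multiplier, the
    corresponding energy has time derivative
    [nu mu (<N_x, i u_x> - <D_h N, i D_h u>)] with [N = |u|^2 u], and this tends
    to [0] with [h], locally uniformly in time. *)

Set Implicit Arguments.
Unset Strict Implicit.
Unset Printing Implicit Defensive.

(** * Semi-inner products *)

(** The obstacle is regularity. The equation may be paired only with $H^1$ functions, while the
    formal energy identity pairs it with $i(\nu u_{xx}+\mu|u|^2u)$, and $u_{xx}$ is only in
    $H^{-1}$. A second difference quotient, being a combination of translates, stays in $H^1$ and is
    a legal multiplier.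

    The conservation argument needs only inner products, isometric translations, multiplication by
    $i$ and a bounded trilinear map, so it is carried out for two abstract spaces. The concrete
    spaces enter through one equivalence: a weak derivative in $L^2$ is the $L^2$ limit of the
    difference quotients. The product rule, the sup bound and $|D_hf|\le|f'|$ all follow from
    translation estimates, without choosing continuous representatives.

    The bounds on the solution and on the profile are linear in [eps] and global in time, so the
    final constant involves neither the time horizon, nor $W$, nor [delta]. *)

Lemma cvg0_norm_le {R : realType} {T : Type} (F : set_system T) {FF : Filter F}
    (f g : T -> R) :
  (forall x, `|f x| <= g x) -> g x @[x --> F] --> 0 -> f x @[x --> F] --> 0.
Proof.
move=> fg g0; apply/norm_cvg0P/(squeeze_cvgr _ (cvg_cst 0) g0).
by near=> x; rewrite normr_ge0 fg.
Unshelve. all: by end_near. Qed.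

Section semi_inner_product.
Context {R : realType} {V : lmodType R}.

(** Definiteness is not demanded: elements of $L^2$ will be functions rather than classes, and a
    function vanishing almost everywhere has norm 0 without being 0. *)
Record semi_inner (ip : V -> V -> R) : Prop := SemiInner {
  sipC : forall x y, ip x y = ip y x;
  sipDl : forall x y z, ip (x + y) z = ip x z + ip y z;
  sipZl : forall a x y, ip (a *: x) y = a * ip x y;
  sip_ge0 : forall x, 0 <= ip x x }.

Definition sinorm (ip : V -> V -> R) (x : V) : R := Num.sqrt (ip x x).

Variable ip : V -> V -> R.
Hypothesis ipP : semi_inner ip.
Local Notation n := (sinorm ip).

Lemma sipDr x y z : ip x (y + z) = ip x y + ip x z.
Proof. by rewrite sipC// sipDl// !(sipC ipP x). Qed.

Lemma sipZr a x y : ip x (a *: y) = a * ip x y.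
Proof. by rewrite sipC// sipZl// (sipC ipP x). Qed.

Lemma sipNl x y : ip (- x) y = - ip x y.
Proof. by rewrite -scaleN1r sipZl// mulN1r. Qed.

Lemma sipNr x y : ip x (- y) = - ip x y.
Proof. by rewrite sipC// sipNl (sipC ipP x). Qed.

Lemma sipBl x y z : ip (x - y) z = ip x z - ip y z.
Proof. by rewrite sipDl// sipNl. Qed.

Lemma sipBr x y z : ip x (y - z) = ip x y - ip x z.
Proof. by rewrite sipDr sipNr. Qed.

Lemma sinorm_ge0 x : 0 <= n x. Proof. exact: sqrtr_ge0. Qed.

Lemma sqr_sinorm x : n x ^+ 2 = ip x x.
Proof. by rewrite sqr_sqrtr// sip_ge0. Qed.

Lemma sip_le x y : `|ip x y| <= n x * n y.
Proof.
rewrite -ler_sqr ?nnegrE ?mulr_ge0 ?sinorm_ge0// exprMn !sqr_sinorm.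
rewrite -normrX ger0_norm ?sqr_ge0//.
have xx := sip_ge0 ipP x; have yy := sip_ge0 ipP y.
have key a b : 0 <= a ^+ 2 * ip x x - a * b * ip x y *+ 2 + b ^+ 2 * ip y y.
  have := sip_ge0 ipP (a *: x - b *: y).
  rewrite !sipBl !sipBr !sipZl// !sipZr (sipC ipP y x); congr (0 <= _); ring.
move: xx; rewrite le_eqVlt => /predU1P[x0|x0].
  (* When [ip x x = 0] these weights turn the nonnegative expression into [- ip x y ^+ 2], which
     forces [ip x y = 0]. *)
  have := key ((ip y y + 1) / 2) (ip x y); rewrite -x0.
  have := sqr_ge0 (ip x y); nra.
have := key (ip x y) (ip x x).
rewrite (_ : _ + _ = ip x x * (ip x x * ip y y - ip x y ^+ 2)); last by ring.
by rewrite pmulr_rge0// subr_ge0.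
Qed.

Lemma sinormD x y : n (x + y) <= n x + n y.
Proof.
rewrite -ler_sqr ?nnegrE ?addr_ge0 ?sinorm_ge0// sqrrD !sqr_sinorm.
rewrite sipDl// !sipDr (sipC ipP y x).
have := sip_le x y; have := ler_norm (ip x y); lra.
Qed.

Lemma sinormZ a x : n (a *: x) = `|a| * n x.
Proof. by rewrite /sinorm sipZl// sipZr mulrA -expr2 sqrtrM ?sqr_ge0// sqrtr_sqr. Qed.

Lemma sinormN x : n (- x) = n x.
Proof. by rewrite -scaleN1r sinormZ normrN1 mul1r. Qed.

Lemma sinormB x y : n (x - y) <= n x + n y.
Proof. by rewrite -(sinormN y) sinormD. Qed.

Lemma sinorm_distC x y : n (x - y) = n (y - x).
Proof. by rewrite -opprB sinormN. Qed.

Lemma sinorm0 : n 0 = 0.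
Proof. by rewrite -(scale0r 0) sinormZ normr0 mul0r. Qed.

Lemma sinorm_triB x y z : n (x - z) <= n (x - y) + n (y - z).
Proof. by rewrite -[x in x - z](subrK y) -addrA sinormD. Qed.

Lemma ler_sinorm_dist x y : `|n x - n y| <= n (x - y).
Proof.
rewrite ler_norml lerBlDl lerNl opprB lerBlDl; apply/andP; split.
  by rewrite sinorm_distC -[leLHS](congr1 n (subrK x y)) addrC sinormD.
by rewrite -[leLHS](congr1 n (subrK y x)) addrC sinormD.
Qed.

Section cvg.
Context {T : Type} {F : set_system T} {FF : Filter F}.

Definition sicvg (a : T -> V) (l : V) := n (a t - l) @[t --> F] --> 0.

Lemma sicvg_cst l : sicvg (fun=> l) l.
Proof. by rewrite /sicvg subrr sinorm0; exact: cvg_cst. Qed.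

Lemma sicvgD a b k l : sicvg a k -> sicvg b l -> sicvg (fun t => a t + b t) (k + l).
Proof.
move=> ak bl; apply: (@cvg0_norm_le _ _ _ _ _ (fun t => n (a t - k) + n (b t - l))).
  by move=> t; rewrite ger0_norm ?sinorm_ge0// opprD addrACA sinormD.
by rewrite -[0]addr0; exact: cvgD.
Qed.

Lemma sicvgZ c a k : sicvg a k -> sicvg (fun t => c *: a t) (c *: k).
Proof.
move=> ak; apply: (@cvg0_norm_le _ _ _ _ _ (fun t => `|c| * n (a t - k))).
  by move=> t; rewrite ger0_norm ?sinorm_ge0// -scalerBr sinormZ.
by rewrite -[0](mulr0 `|c|); apply: cvgM => //; exact: cvg_cst.
Qed.

Lemma sicvgN a k : sicvg a k -> sicvg (fun t => - a t) (- k).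
Proof.
by move=> /(sicvgZ (-1)); rewrite scaleN1r; under eq_fun do rewrite scaleN1r.
Qed.

Lemma sicvg_norm a k : sicvg a k -> n (a t) @[t --> F] --> n k.
Proof.
move=> ak; apply/subr_cvg0.
by apply: cvg0_norm_le ak => t; exact: ler_sinorm_dist.
Qed.

Lemma sip_cvg a b k l : sicvg a k -> sicvg b l ->
  ip (a t) (b t) @[t --> F] --> ip k l.
Proof.
move=> ak bl; apply/subr_cvg0.
apply: (@cvg0_norm_le _ _ _ _ _
  (fun t => n (a t - k) * n (b t) + n k * n (b t - l))).
  move=> t; rewrite [X in `|X|](_ : _ = ip (a t - k) (b t) + ip k (b t - l)).
    by rewrite (le_trans (ler_normD _ _))// lerD ?sip_le.
  by rewrite /= sipBl sipBr; ring.
rewrite (_ : 0 = 0 * n l + n k * 0); last by rewrite mul0r mulr0 addr0.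
apply: cvgD; first by apply: cvgM; [exact: ak|exact: sicvg_norm].
by apply: cvgM; [exact: cvg_cst|exact: bl].
Qed.

End cvg.

Lemma sicvg_comp {S T : Type} (F : set_system S) (G : set_system T)
    (g : S -> T) (a : T -> V) (l : V) :
  g @ F --> G -> @sicvg T G a l -> @sicvg S F (a \o g) l.
Proof. exact: (@cvg_comp _ _ _ _ (fun t => n (a t - l))). Qed.

End semi_inner_product.
Arguments sicvg {R V} ip {T} F a l.

(** * Mean value theorem and derivative criteria on the real line *)

Lemma MVT_ball {R : realType} (f df : R -> R) (t r : R) :
  (forall x, ball t r x -> is_derive x 1 f (df x)) ->
  forall x y, ball t r x -> ball t r y ->
  exists2 c, ball t r c & f y - f x = df c * (y - x).
Proof.
move=> fdf.
have wlg x y : x <= y -> ball t r x -> ball t r y ->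
    exists2 c, ball t r c & f y - f x = df c * (y - x).
  rewrite /ball/= => xy xt yt.
  have sub c : x <= c <= y -> `|t - c| < r.
    by move: xt yt; rewrite !ltr_norml; lra.
  have [||c cxy ->] := @MVT_segment R f df x y xy.
  - by move=> z; rewrite in_itv/= => zxy; apply: fdf; apply: sub; lra.
  - apply: derivable_within_continuous => z; rewrite in_itv/= => zxy.
    by have [] := fdf z (sub _ zxy).
  - by exists c => //; apply: sub; move: cxy; rewrite in_itv.
move=> x y xt yt; have [xy|/ltW yx] := leP x y; first exact: wlg.
have [c ct e] := wlg _ _ yx yt xt; exists c => //.
by rewrite -opprB e -mulrN opprB.
Qed.

Lemma is_derive_bound {R : realType} (f : R -> R) (t d : R) :
  (forall e, 0 < e -> \forall s \near t, `|f s - f t - (s - t) * d| <= e * `|s - t|) ->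
  is_derive t 1 f d.
Proof.
move=> fd.
have cv : h^-1 *: (f (h *: 1 + t) - f t) @[h --> 0^'] --> d.
  apply/subr_cvg0/cvgr0Pnorm_le => e e0.
  have : \forall h \near 0^', `|f (h + t) - f t - h * d| <= e * `|h|.
    apply: cvg_within; have := fd e e0; rewrite (near_shift 0 t).
    by apply: filterS => h /=; rewrite subr0 addrK.
  move=> H; near=> h.
  have h0 : h != 0 by near: h; exact: nbhs_dnbhs_neq.
  have -> : h^-1 *: (f (h *: 1 + t) - f t) - d = h^-1 * (f (h + t) - f t - h * d).
    by rewrite /GRing.scale/= mulr1; field.
  rewrite normrM normfV ler_pdivrMl ?normr_gt0// [leRHS]mulrC.
  by near: h.
apply: DeriveDef; last exact/cvg_lim.
by apply/cvg_ex; exists d.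
Unshelve. all: by end_near. Qed.

(** The endpoint is left out of the derivative hypothesis because the equation holds for positive
    times only; at time 0 the path is merely continuous. *)
Lemma is_derive0_cst {R : realType} (f : R -> R) (a : R) :
  (forall t, a < t -> is_derive t 1 f 0) ->
  {within `[a, +oo[, continuous f} ->
  forall t, a <= t -> f t = f a.
Proof.
move=> fd fc t; rewrite le_eqVlt => /predU1P[->//|at_].
have [||c _ /eqP] := @MVT R f (fun=> 0) a t at_.
- by move=> x; rewrite in_itv/= => /andP[ax _]; exact: fd.
- by apply: continuous_subspaceW fc => x/=; rewrite !in_itv/= => /andP[->].
- by rewrite mul0r subr_eq0 => /eqP.
Qed.

(** * Conservation laws for an abstract cubic Schrödinger equation *)

Section nls_conservation.
Context {R : realType} {L H : lmodType R}.
(* Intended model: [L] is L^2 and [H] is H^1, [e0 f] and [e1 f] are [f] and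
   [f'], [J] is multiplication by [i], [T h] is translation by [h], and
   [tri a b c] is [Re (a conj b) c]. *)
Variables (ip : L -> L -> R) (J : {linear L -> L}) (T : R -> {linear L -> L}).
Variables (e0 e1 : {linear H -> L}) (JH : {linear H -> H}).
Variables (TH : R -> {linear H -> H}) (tri : H -> H -> H -> H) (C : R).

Let e0D f g : e0 (f + g) = e0 f + e0 g. Proof. exact: raddfD. Qed.
Let e1D f g : e1 (f + g) = e1 f + e1 g. Proof. exact: raddfD. Qed.
Let e0B f g : e0 (f - g) = e0 f - e0 g. Proof. exact: raddfB. Qed.
Let e1B f g : e1 (f - g) = e1 f - e1 g. Proof. exact: raddfB. Qed.
Let e0Z a f : e0 (a *: f) = a *: e0 f. Proof. exact: linearZ. Qed.
Let e1Z a f : e1 (a *: f) = a *: e1 f. Proof. exact: linearZ. Qed.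
Let JD x y : J (x + y) = J x + J y. Proof. exact: raddfD. Qed.
Let JB x y : J (x - y) = J x - J y. Proof. exact: raddfB. Qed.
Let JZ a x : J (a *: x) = a *: J x. Proof. exact: linearZ. Qed.
Let TD h x y : T h (x + y) = T h x + T h y. Proof. exact: raddfD. Qed.
Let TB h x y : T h (x - y) = T h x - T h y. Proof. exact: raddfB. Qed.

Let THZ h a f : TH h (a *: f) = a *: TH h f. Proof. exact: linearZ. Qed.

Definition graph_ip (f g : H) : R := ip (e0 f) (e0 g) + ip (e1 f) (e1 g).
Local Notation hip := graph_ip.
Local Notation n := (sinorm ip).
Local Notation hn := (sinorm hip).
Local Notation q a b c d := (ip (e0 (tri a b c)) (e0 d)).

Hypothesis ipP : semi_inner ip.
Hypothesis ipJ : forall x y, ip (J x) y = - ip x (J y).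
Hypothesis JJ : forall x, J (J x) = - x.
Hypothesis ipT : forall h x y, ip (T h x) (T h y) = ip x y.
Hypothesis TK : forall h x, T h (T (- h) x) = x.
Hypothesis TJ : forall h x, T h (J x) = J (T h x).
Hypothesis e0J : forall f, e0 (JH f) = J (e0 f).
Hypothesis e1J : forall f, e1 (JH f) = J (e1 f).
Hypothesis e0T : forall h f, e0 (TH h f) = T h (e0 f).
Hypothesis e1T : forall h f, e1 (TH h f) = T h (e1 f).
Hypothesis diffquot_le : forall h f, n (T h (e0 f) - e0 f) <= `|h| * n (e1 f).
Hypothesis diffquot_cvg : forall f,
  n (h^-1 *: (T h (e0 f) - e0 f) - e1 f) @[h --> 0^'] --> 0.
Hypothesis triBl : forall a a' b c, tri (a - a') b c = tri a b c - tri a' b c.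
Hypothesis triBm : forall a b b' c, tri a (b - b') c = tri a b c - tri a b' c.
Hypothesis triBr : forall a b c c', tri a b (c - c') = tri a b c - tri a b c'.
Hypothesis tri_le : forall a b c, hn (tri a b c) <= C * (hn a * hn b * hn c).
Hypothesis qCr : forall a b c d, q a b c d = q a b d c.
Hypothesis qX : forall a b c d, q a b c d = q c d a b.
Hypothesis qJ : forall a b, q a a b (JH b) = 0.

Lemma graph_ipP : semi_inner hip.
Proof.
split=> [x y|x y z|a x y|x]; rewrite /hip.
- by rewrite (sipC ipP (e0 x)) (sipC ipP (e1 x)).
- by rewrite e0D e1D !(sipDl ipP); ring.
- by rewrite e0Z e1Z !(sipZl ipP); ring.
- by rewrite addr_ge0 ?sip_ge0.
Qed.
Let hipP := graph_ipP.

Lemma ipJJ x y : ip (J x) (J y) = ip x y.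
Proof. by rewrite ipJ JJ sipNr// opprK. Qed.

Lemma ipxJx x : ip x (J x) = 0.
Proof. have := ipJ x x; rewrite sipC//; lra. Qed.

Lemma sinorm_J x : n (J x) = n x. Proof. by rewrite /sinorm ipJJ. Qed.
Lemma sinorm_e0_le f : n (e0 f) <= hn f.
Proof. by rewrite ler_wsqrtr// lerDl sip_ge0. Qed.

Lemma sinorm_e1_le f : n (e1 f) <= hn f.
Proof. by rewrite ler_wsqrtr// lerDr sip_ge0. Qed.

Lemma triDr a b c c' : tri a b (c + c') = tri a b c + tri a b c'.
Proof.
have := triBr a b (c + c') c'; rewrite addrK => ->.
by rewrite subrK.
Qed.

Section cvg.
Context {X : Type} {F : set_system X} {FF : Filter F}.

Lemma sicvg_e0 a l : sicvg hip F a l -> sicvg ip F (e0 \o a) (e0 l).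
Proof.
apply: cvg0_norm_le => x; rewrite ger0_norm ?sinorm_ge0//= -e0B.
exact: sinorm_e0_le.
Qed.

Lemma sicvg_e1 a l : sicvg hip F a l -> sicvg ip F (e1 \o a) (e1 l).
Proof.
apply: cvg0_norm_le => x; rewrite ger0_norm ?sinorm_ge0//= -e1B.
exact: sinorm_e1_le.
Qed.

Lemma sicvg_J a l : sicvg hip F a l -> sicvg hip F (JH \o a) (JH l).
Proof.
apply: cvg0_norm_le => x; rewrite ger0_norm ?sinorm_ge0//= -(raddfB JH).
by rewrite /sinorm /hip !e0J !e1J !ipJJ.
Qed.

Lemma sicvg_T h a l : sicvg hip F a l -> sicvg hip F (TH h \o a) (TH h l).
Proof.
apply: cvg0_norm_le => x; rewrite ger0_norm ?sinorm_ge0//= -(raddfB (TH h)).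
by rewrite /sinorm /hip !e0T !e1T !ipT.
Qed.

Lemma sicvg_tri a b c k l m :
  sicvg hip F a k -> sicvg hip F b l -> sicvg hip F c m ->
  sicvg hip F (fun t => tri (a t) (b t) (c t)) (tri k l m).
Proof.
move=> ak bl cm; apply: (@cvg0_norm_le _ _ _ _ _
  (fun t => C * (hn (a t - k) * hn (b t) * hn (c t)
               + hn k * hn (b t - l) * hn (c t)
               + hn k * hn l * hn (c t - m)))).
  move=> t; rewrite ger0_norm ?sinorm_ge0//.
  have -> : tri (a t) (b t) (c t) - tri k l m =
      tri (a t - k) (b t) (c t) + tri k (b t - l) (c t) + tri k l (c t - m).
    by rewrite triBl triBm triBr !addrA !subrK.
  rewrite !mulrDr; apply: le_trans (sinormD hipP _ _) (lerD _ (tri_le _ _ _)).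
  by apply: le_trans (sinormD hipP _ _) (lerD (tri_le _ _ _) (tri_le _ _ _)).
have bl' : hn (b t) @[t --> F] --> hn l by exact: (sicvg_norm hipP).
have cm' : hn (c t) @[t --> F] --> hn m by exact: (sicvg_norm hipP).
rewrite (_ : 0 = C * (0 * hn l * hn m + hn k * 0 * hn m + hn k * hn l * 0));
  last by ring.
apply: cvgM; first exact: cvg_cst.
apply: cvgD; first apply: cvgD.
- exact: (cvgM (cvgM ak bl') cm').
- exact: (cvgM (cvgM (cvg_cst _) bl) cm').
- exact: (cvgM (cvg_cst _) cm).
Qed.

End cvg.

(** Discrete Laplacian, equal to $-D_h^*D_h$. Its version on [H] keeps values in [H], which the
    second derivative would not. *)
Definition lap (h : R) (x : L) : L := h ^- 2 *: (T h x + T (- h) x - (x + x)).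
Definition laph (h : R) (f : H) : H := h ^- 2 *: (TH h f + TH (- h) f - (f + f)).

Lemma e0_lap h f : e0 (laph h f) = lap h (e0 f).
Proof. by rewrite /laph e0Z e0B !e0D !e0T. Qed.

Lemma e1_lap h f : e1 (laph h f) = lap h (e1 f).
Proof. by rewrite /laph e1Z e1B !e1D !e1T. Qed.

Lemma ip_lap h x y : ip x (lap h y) = - h ^- 2 * ip (T h x - x) (T h y - y).
Proof.
rewrite sipZr// mulNr -mulrN; congr (_ * _).
have -> : ip x (T h y + T (- h) y - (y + y)) =
    ip x (T h y) + ip (T h x) y - ip x y - ip x y.
  by rewrite (sipBr ipP) !(sipDr ipP) -(ipT h x (T (- h) y)) TK; ring.
by rewrite (sipBl ipP) !(sipBr ipP) ipT; ring.
Qed.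

Lemma lap_J h x : lap h (J x) = J (lap h x).
Proof. by rewrite /lap JZ JB !JD !TJ. Qed.

(** [lap h] is symmetric and commutes with the skew map [J], so [J \o lap h] is skew. *)
Lemma ip_lap_J h x : ip x (J (lap h x)) = 0.
Proof.
have e : ip x (J (lap h x)) = ip (lap h x) (J x).
  by rewrite -lap_J (sipC ipP (lap h x)) !ip_lap (sipC ipP (T h x - x)).
have := ipJ (lap h x) x; rewrite (sipC ipP) e; lra.
Qed.

Variables (nu mu : R).

Definition nls_rhs (w f : H) : R := nu * ip (e1 w) (e1 f) - mu * q w w w f.

Lemma nls_rhs_cvg {X : Type} {F : set_system X} {FF : Filter F} a b k l :
  sicvg hip F a k -> sicvg hip F b l ->
  nls_rhs (a t) (b t) @[t --> F] --> nls_rhs k l.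
Proof.
move=> ak bl; apply: cvgB; apply: cvgM; try exact: cvg_cst.
  by apply: sip_cvg => //; exact: sicvg_e1.
by apply: sip_cvg => //; apply: sicvg_e0 => //; exact: sicvg_tri.
Qed.

Definition energy (w : H) : R :=
  nu / 2 * ip (e1 w) (e1 w) - mu / 4 * q w w w w.

Definition diffquot_energy (h : R) (w : H) : R :=
  nu / 2 * (h ^- 2 * ip (T h (e0 w) - e0 w) (T h (e0 w) - e0 w))
  - mu / 4 * q w w w w.

(** Gradient of [diffquot_energy] symmetrised in two states. For [a = b = w] it is
    $-\nu\Delta_hw-\mu|w|^2w$, with $\Delta_h$ the discrete Laplacian. *)
Definition energy_multiplier (h : R) (a b : H) : H :=
  - (nu / 2) *: laph h (a + b)
  - mu / 4 *: (tri a a (a + b) + tri b b (a + b)).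

(** The increment is an exact pairing with no remainder, as [nls_moving_test] requires. The quartic
    part rests on $|b|^4-|a|^4=(|a|^2+|b|^2)\,\mathrm{Re}\,(b-a)\overline{(a+b)}$, the quadratic
    part on summation by parts. *)
Lemma diffquot_energyB h a b :
  diffquot_energy h b - diffquot_energy h a
  = ip (e0 (b - a)) (e0 (energy_multiplier h a b)).
Proof.
rewrite /energy_multiplier !e0B e0Z e0_lap e0Z !e0D !triDr !e0D (sipBr ipP).
rewrite (sipZr ipP) ip_lap (sipZr ipP) !(sipBl ipP) !(sipDr ipP) !TB !TD.
rewrite /diffquot_energy !(sipBl ipP, sipBr ipP, sipDl ipP, sipDr ipP, sipNr ipP).
rewrite !(sipC ipP (e0 a) (T h _)) !(sipC ipP (e0 b) (T h _)).
rewrite (sipC ipP (T h (e0 b)) (T h (e0 a))) (sipC ipP (e0 b) (e0 a)).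
rewrite !(sipC ipP (e0 a) (e0 (tri _ _ _))) !(sipC ipP (e0 b) (e0 (tri _ _ _))).
rewrite (qCr a a b a) (qCr b b b a) (qX b b a a).
by move: (h ^- 2) => k; field.
Qed.

Definition nls_slope (h : R) (w : H) : R :=
  nu * mu * (ip (e1 (tri w w w)) (J (e1 w))
             - h ^- 2 * ip (T h (e0 (tri w w w)) - e0 (tri w w w))
                           (J (T h (e0 w) - e0 w))).

(** With $N=|w|^2w$, the terms $\langle w_x,i\Delta_hw_x\rangle$ and $\langle N,iN\rangle$ vanish by
    skewness. Only the two cross terms between dispersion and nonlinearity survive, and they would
    cancel if $D_h$ were the derivative. *)
Lemma nls_rhs_multiplier h w :
  nls_rhs w (JH (energy_multiplier h w w)) = nls_slope h w.
Proof.
have dbl (f : H) : f + f = 2 *: f by rewrite scaler_nat mulr2n.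
have tri2 : tri w w (2 *: w) = 2 *: tri w w w by rewrite -!dbl triDr.
have lap2 : laph h (2 *: w) = 2 *: laph h w.
  rewrite /laph !THZ -!scalerDr -scalerBr !scalerA.
  by congr (_ *: _); ring.
rewrite /nls_rhs e0J e1J /energy_multiplier !dbl tri2 lap2.
rewrite (scalerA _ 2 (laph _ _)) (scalerA 2 2) (scalerA (mu / 4)).
rewrite e0B e1B e0Z e1Z e0_lap e1_lap e0Z e1Z !JB (JZ _ (lap _ _)) (JZ _ (lap _ _)).
rewrite !(sipBr ipP) 2!(sipZr ipP) ip_lap_J -lap_J ip_lap !JZ !(sipZr ipP) ipxJx.
rewrite /nls_slope TJ JB (sipC ipP (e1 w)) ipJ.
by move: (h ^- 2) => k; field.
Qed.

Variable u : R -> H.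
Hypothesis u_cont : forall t : R, 0 <= t ->
  sicvg hip (within `[0, +oo[ (nbhs t)) u (u t).
Hypothesis u_eq : forall t : R, 0 < t -> forall f,
  is_derive t 1 (fun s => ip (J (e0 (u s))) (e0 f)) (nls_rhs (u t) f).

Lemma u_nbhs_cont (t : R) : 0 < t -> sicvg hip (nbhs t) u (u t).
Proof.
move=> t0; have := u_cont (ltW t0); rewrite /sicvg within_interior//.
by apply: filterS (lt_nbhsr t0) => s /= /ltW s0; rewrite in_itv/= s0.
Qed.

(* The weak equation only gives the derivative against a fixed test function;
   the mean value theorem and continuity in the graph norm let the test
   function vary with time. *)
Lemma nls_moving_test (t : R) (F : R -> R) (Phi : R -> H) : 0 < t ->
  sicvg hip (nbhs t) Phi (Phi t) ->
  (forall s, F s - F t = ip (e0 (u s - u t)) (e0 (Phi s))) ->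
  is_derive t 1 F (nls_rhs (u t) (JH (Phi t))).
Proof.
move=> t0 Phic FE; apply: is_derive_bound => e e_gt0.
have joint : nls_rhs (u z.1) (JH (Phi z.2)) @[z --> (nbhs t, nbhs t)] -->
    nls_rhs (u t) (JH (Phi t)).
  apply: nls_rhs_cvg.
    exact: (sicvg_comp cvg_fst (u_nbhs_cont t0)).
  by apply: (sicvg_J (a := Phi \o snd)); exact: (sicvg_comp cvg_snd Phic).
have /cvgrPdist_le/(_ e e_gt0)[/= [A B]/= [tA tB] AB] := joint.
have [r /= r0 rA] : exists2 r : R, 0 < r & ball t r `<=` A `&` B `&` [set s | 0 < s].
  by apply/nbhs_ballP; apply: filterI; [exact: filterI|exact: lt_nbhsr].
near=> s.
have sr : ball t r s by near: s; exact: nbhsx_ballx.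
have tr : ball t r t by exact: ballxx.
have [x xr|c ct] := @MVT_ball R (fun x => ip (J (e0 (u x))) (e0 (JH (Phi s))))
  (fun x => nls_rhs (u x) (JH (Phi s))) t r _ t s tr sr.
  by apply: u_eq; have [] := rA _ xr.
rewrite !e0J !ipJJ -sipBl// -e0B -FE => ->.
rewrite mulrC -mulrBr normrM mulrC ler_wpM2r// distrC.
by apply: (AB (c, s)); split => /=; [have [[]] := rA _ ct|have [[]] := rA _ sr].
Unshelve. all: by end_near. Qed.

Lemma mass_derive0 (t : R) : 0 < t ->
  is_derive t 1 (fun s => ip (e0 (u s)) (e0 (u s))) 0.
Proof.
move=> t0.
have -> : 0 = nls_rhs (u t) (JH (u t + u t)).
  rewrite (raddfD JH) /nls_rhs e0D e1D !(sipDr ipP) e1J ipxJx. by rewrite qJ; ring.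
apply: (nls_moving_test (Phi := fun s => u s + u t)) => //.
  by have hP := graph_ipP; apply: sicvgD => //; [exact: u_nbhs_cont|exact: sicvg_cst].
move=> s; rewrite e0B e0D sipBl// !sipDr// (sipC ipP (e0 (u t)) (e0 (u s))); ring.
Qed.

Lemma diffquot_energy_derive (h t : R) : 0 < t ->
  is_derive t 1 (fun s => diffquot_energy h (u s)) (nls_slope h (u t)).
Proof.
move=> t0; rewrite -nls_rhs_multiplier.
apply: (nls_moving_test (Phi := fun s => energy_multiplier h (u t) (u s))) => //.
- have ut := u_nbhs_cont t0; have hP := graph_ipP.
  have us : sicvg hip (nbhs t) (fun s => u t + u s) (u t + u t).
    by apply: sicvgD => //; exact: sicvg_cst.
  apply: sicvgD => //.
    apply: sicvgZ => //; apply: sicvgZ => //; apply: sicvgD => //.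
      by apply: sicvgD => //; apply: sicvg_T.
    by apply: sicvgN => //; exact: sicvgD.
  apply: sicvgN => //; apply: sicvgZ => //; apply: sicvgD => //.
    by apply: sicvg_tri => //; exact: sicvg_cst.
  exact: sicvg_tri.
- by move=> s; exact: diffquot_energyB.
Qed.

Definition diffquot_rem (h : R) (f : H) : L :=
  h^-1 *: (T h (e0 f) - e0 f) - e1 f.

Lemma sinorm_diffquot h f : n (h^-1 *: (T h (e0 f) - e0 f)) <= n (e1 f).
Proof.
rewrite sinormZ// normfV; have [->|h0] := eqVneq h 0.
  by rewrite normr0 invr0 mul0r sinorm_ge0.
by rewrite ler_pdivrMl ?normr_gt0// diffquot_le.
Qed.

Lemma diffquot_remD h f g :
  diffquot_rem h (f + g) = diffquot_rem h f + diffquot_rem h g.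
Proof.
rewrite /diffquot_rem e0D e1D TD (opprD (e0 f)) (addrACA (T h (e0 f))).
by rewrite scalerDr opprD addrACA.
Qed.

Lemma sinorm_diffquot_rem h f : n (diffquot_rem h f) <= 2 * hn f.
Proof.
rewrite (le_trans (sinormB ipP _ _))// mulr_natl mulr2n lerD ?sinorm_e1_le//.
exact: le_trans (sinorm_diffquot _ _) (sinorm_e1_le _).
Qed.

(** The remainder is additive in the function and bounded by twice its norm uniformly in [h].
    Convergence for the fixed function [f t] therefore upgrades to a joint limit in step and time,
    which is the local uniformity needed for the energy. *)
Lemma diffquot_rem_cvg (t : R) (f : R -> H) : sicvg hip (nbhs t) f (f t) ->
  n (diffquot_rem z.1 (f z.2)) @[z --> (0^' : set_system R, nbhs t)] --> 0.
Proof.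
move=> ft; apply: (@cvg0_norm_le _ _ _ _ _
  (fun z : R * R => n (diffquot_rem z.1 (f t)) + 2 * hn (f z.2 - f t))).
  move=> z; rewrite ger0_norm ?sinorm_ge0//.
  rewrite -{1}(subrK (f t) (f z.2)) diffquot_remD addrC.
  by rewrite (le_trans (sinormD ipP _ _))// lerD2l sinorm_diffquot_rem.
suff : n (diffquot_rem z.1 (f t)) + 2 * hn (f z.2 - f t)
    @[z --> (0^' : set_system R, nbhs t)] --> (0 + 2 * 0 : R) by rewrite mulr0 addr0.
apply: cvgD; first exact: (@cvg_comp _ _ _ fst (fun h => n (diffquot_rem h (f t))) _ _ _ cvg_fst
    (diffquot_cvg (f t))).
apply: cvgM; first exact: cvg_cst.
exact: (sicvg_comp cvg_snd ft).
Qed.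

(** The difference of the two pairings telescopes: one factor at a time is replaced by its
    difference quotient, and each replacement costs one remainder. *)
Lemma nls_slope_le h w : `|nls_slope h w| <= `|nu * mu| *
  (n (diffquot_rem h (tri w w w)) * n (e1 w)
   + n (e1 (tri w w w)) * n (diffquot_rem h w)).
Proof.
rewrite normrM ler_wpM2l//.
set X := T h (e0 (tri w w w)) - _; set Y := T h (e0 w) - _.
have -> : ip (e1 (tri w w w)) (J (e1 w)) - h ^- 2 * ip X (J Y) =
    - (ip (diffquot_rem h (tri w w w)) (J (h^-1 *: Y))
       + ip (e1 (tri w w w)) (J (diffquot_rem h w))).
  rewrite /diffquot_rem -/X -/Y; move: X Y => X Y.
  rewrite JB JZ !(sipBl ipP) !(sipBr ipP) !(sipZl ipP) !(sipZr ipP) -exprVn; ring.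
rewrite normrN (le_trans (ler_normD _ _))// lerD// (le_trans (sip_le ipP _ _))//.
  by rewrite sinorm_J ler_wpM2l ?sinorm_ge0// sinorm_diffquot.
by rewrite sinorm_J.
Qed.

Lemma nls_slope_cvg (t : R) : 0 < t ->
  nls_slope z.1 (u z.2) @[z --> (0^' : set_system R, nbhs t)] --> 0.
Proof.
move=> t0; apply: (@cvg0_norm_le _ _ _ _ _ (fun z : R * R => _)).
  by move=> z; exact: nls_slope_le.
have ut := u_nbhs_cont t0; have hP := graph_ipP.
have trit : sicvg hip (nbhs t) (fun s => tri (u s) (u s) (u s)) (tri (u t) (u t) (u t)).
  exact: sicvg_tri.
pose N s := tri (u s) (u s) (u s).
suff : `|nu * mu| * (n (diffquot_rem z.1 (N z.2)) * n (e1 (u z.2)) +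
      n (e1 (N z.2)) * n (diffquot_rem z.1 (u z.2)))
    @[z --> (0^' : set_system R, nbhs t)] -->
    (`|nu * mu| * (0 * n (e1 (u t)) + n (e1 (N t)) * 0) : R).
  by rewrite mul0r mulr0 addr0 mulr0.
apply: cvgM; first exact: cvg_cst.
have e1c f : sicvg hip (nbhs t) f (f t) ->
    n (e1 (f z.2)) @[z --> (0^' : set_system R, nbhs t)] --> n (e1 (f t)).
  move=> ft; apply: (sicvg_norm ipP (a := fun z : R * R => e1 (f z.2))).
  exact: (sicvg_comp cvg_snd (sicvg_e1 ft)).
apply: cvgD; apply: cvgM.
- exact: diffquot_rem_cvg trit.
- exact: e1c.
- exact: (e1c N).
- exact: diffquot_rem_cvg.
Qed.

Lemma diffquot_energy_cvg w : diffquot_energy h w @[h --> 0^'] --> energy w.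
Proof.
apply: cvgB; last exact: cvg_cst.
apply: cvgM; first exact: cvg_cst.
have -> : (fun h => h ^- 2 * ip (T h (e0 w) - e0 w) (T h (e0 w) - e0 w)) =
    (fun h => ip (h^-1 *: (T h (e0 w) - e0 w)) (h^-1 *: (T h (e0 w) - e0 w))).
  by apply/funext => h; rewrite (sipZl ipP) (sipZr ipP) mulrA -expr2 exprVn.
by apply: (sip_cvg ipP); exact: diffquot_cvg.
Qed.

(** The joint limit makes the slope at most [e] for all small steps and all times near [t]. The mean
    value theorem in time is applied with the step fixed; the step is sent to 0 afterwards, in the
    resulting inequality. *)
Lemma energy_derive0 (t : R) : 0 < t -> is_derive t 1 (energy \o u) 0.
Proof.
move=> t0; apply: is_derive_bound => e e_gt0.
have /cvgrPdist_le/(_ e e_gt0)[/= [A B]/= [tA tB] AB] := nls_slope_cvg t0.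
have [r /= r0 rB] : exists2 r : R, 0 < r & ball t r `<=` B `&` [set s | 0 < s].
  by apply/nbhs_ballP; apply: filterI => //; exact: lt_nbhsr.
near=> s.
have sr : ball t r s by near: s; exact: nbhsx_ballx.
have tr : ball t r t by exact: ballxx.
rewrite mulr0 subr0 /=.
have lim : `|diffquot_energy h (u s) - diffquot_energy h (u t)| @[h --> 0^'] -->
    `|energy (u s) - energy (u t)|.
  by apply: cvg_norm; apply: cvgB; exact: diffquot_energy_cvg.
apply: (cvgr_to_le lim); near=> h.
have hA : A h by near: h.
have [x xr|c ct ->] := @MVT_ball R (fun x => diffquot_energy h (u x))
  (fun x => nls_slope h (u x)) t r _ t s tr sr.
  by apply: diffquot_energy_derive; have [] := rB _ xr.
rewrite normrM ler_wpM2r//.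
have := AB (h, c); rewrite /= sub0r normrN; apply; split => //=.
by have [] := rB _ ct.
Unshelve. all: by end_near. Qed.

(** The first hypothesis allows every filter so that it covers neighbourhoods restricted to
    nonnegative times, the only ones along which [u] is continuous at 0. *)
Lemma functional_conserved (F : H -> R) :
  (forall (X : set_system R), Filter X -> forall t,
     sicvg hip X u (u t) -> F (u s) @[s --> X] --> F (u t)) ->
  (forall t : R, 0 < t -> is_derive t 1 (F \o u) 0) ->
  forall t : R, 0 <= t -> F (u t) = F (u 0).
Proof.
move=> Fc F0 t t0; apply: (@is_derive0_cst _ (F \o u) 0) => //.
apply/subspace_continuousP => x; rewrite /= in_itv/= andbT => x0.
by apply: Fc; exact: u_cont.
Qed.

Lemma mass_conserved (t : R) : 0 <= t -> n (e0 (u t)) = n (e0 (u 0)).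
Proof.
move=> t0; congr Num.sqrt; move: t t0.
apply: (functional_conserved (F := fun w => ip (e0 w) (e0 w))).
  by move=> X FX t ut; apply: (sip_cvg ipP); exact: sicvg_e0.
exact: mass_derive0.
Qed.

Lemma energy_conserved (t : R) : 0 <= t -> energy (u t) = energy (u 0).
Proof.
move: t; apply: functional_conserved; last exact: energy_derive0.
move=> X FX t ut; apply: cvgB; apply: cvgM; try exact: cvg_cst.
  by apply: (sip_cvg ipP); exact: sicvg_e1.
by apply: (sip_cvg ipP); apply: sicvg_e0 => //; exact: sicvg_tri.
Qed.

Variable G : R.
Hypothesis nu_gt0 : 0 < nu.
Hypothesis mu_ge0 : 0 <= mu.
Hypothesis G_ge0 : 0 <= G.
Hypothesis q_ge0 : forall a, 0 <= q a a a a.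
Hypothesis q_le : forall a, q a a a a <= G * n (e0 a) ^+ 3 * n (e1 a).

(** Write $m$ for the conserved mass norm and $X$, $X_0$ for the norms of $u_x$ at times $t$ and
    $0$. Energy conservation gives $X^2\le X_0^2+km^3X$. The right-hand side is only linear in $X$,
    so Young's inequality absorbs it: $X^2\le2X_0^2+k^2m^6$. *)
Lemma nls_apriori_bound (t : R) : 0 <= t ->
  hn (u t) ^+ 2 <= 2 * hn (u 0) ^+ 2 + (mu * G / (2 * nu)) ^+ 2 * hn (u 0) ^+ 6.
Proof.
move=> t0; have hP := graph_ipP.
have := energy_conserved t0; rewrite /energy -!(sqr_sinorm ipP).
have := q_le (u t); rewrite (mass_conserved t0); have := q_ge0 (u 0).
rewrite (exprM _ 2 3) !(sqr_sinorm hP) /hip -!(sqr_sinorm ipP) (mass_conserved t0).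
have := sinorm_ge0 ip (e0 (u 0)).
move: (n (e0 (u 0))) (n (e1 (u 0))) (n (e1 (u t))) => m X0 X m0.
move: (q _ _ _ _) (q _ _ _ _) => q0 qt q0_ge0 qt_le E.
set k := mu * G / (2 * nu).
(* The initial quartic term enters the energy with a favourable sign and is dropped. *)
have XX : X ^+ 2 <= X0 ^+ 2 + k * m ^+ 3 * X.
  rewrite -(@ler_pM2l _ (nu / 2)) ?divr_gt0// mulrDr.
  have -> : nu / 2 * (k * m ^+ 3 * X) = mu / 4 * (G * m ^+ 3 * X).
    by rewrite /k; field; rewrite gt_eqF.
  have mu4 : 0 <= mu / 4 by rewrite divr_ge0.
  have := ler_wpM2l mu4 qt_le; have := mulr_ge0 mu4 q0_ge0; lra.
have m6 : (k * m ^+ 3) ^+ 2 <= k ^+ 2 * (m ^+ 2 + X0 ^+ 2) ^+ 3.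
  rewrite exprMn ler_wpM2l ?sqr_ge0// -exprM mulnC exprM.
  by rewrite lerXn2r ?nnegrE ?addr_ge0 ?sqr_ge0// lerDl sqr_ge0.
have := sqr_ge0 (k * m ^+ 3 - X); rewrite sqrrB.
have := sqr_ge0 m; lra.
Qed.
End nls_conservation.

(** * The space of square-integrable functions *)

Section square_integrable.
Context {R : realType}.
Local Notation mu := (@lebesgue_measure R).
Implicit Types f g : R -> R.

Definition l2 : {pred R -> R} := fun f =>
  `[< measurable_fun setT f /\ mu.-integrable setT (fun x => (f x ^+ 2)%:E) >].

Lemma l2P f : reflect
  (measurable_fun setT f /\ mu.-integrable setT (fun x => (f x ^+ 2)%:E)) (f \in l2).
Proof. exact: asboolP. Qed.

Lemma l2_measurable f : f \in l2 -> measurable_fun setT f.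
Proof. by case/l2P. Qed.

Lemma l2_le f g : measurable_fun setT f -> g \in l2 ->
  (forall x, `|f x| <= `|g x|) -> f \in l2.
Proof.
move=> mf /l2P[mg ig] fg; apply/l2P; split=> //.
apply: le_integrable ig => //; first exact/measurable_EFinP/measurable_funX.
by move=> x _; rewrite lee_fin !normrX lerXn2r ?nnegrE.
Qed.

Lemma integrable_l2M f g : f \in l2 -> g \in l2 ->
  mu.-integrable setT (fun x => (f x * g x)%:E).
Proof.
move=> /l2P[mf If] /l2P[mg Ig].
apply: (le_integrable _ _ _ (integrableD _ If Ig)) => //.
  exact/measurable_EFinP/measurable_funM.
move=> x _ /=; rewrite lee_fin.
have fg0 : 0 <= f x ^+ 2 + g x ^+ 2 by rewrite addr_ge0 ?sqr_ge0.
rewrite (ger0_norm fg0) ler_norml.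
have := sqr_ge0 (f x + g x); have := sqr_ge0 (f x - g x).
have := sqr_ge0 (f x); have := sqr_ge0 (g x); lra.
Qed.

Lemma l2_submod_closed : submod_closed l2.
Proof.
split.
  apply/l2P; split; first exact: measurable_cst.
  rewrite (_ : (fun x => _) = cst 0%E); first exact: integrable0.
  by apply/funext => x; rewrite /= expr0n.
move=> a f g fl gl; have mf := l2_measurable fl; have mg := l2_measurable gl.
apply/l2P; split.
  by apply: measurable_funD => //; apply: measurable_funM => //.
rewrite (_ : (fun x => _) = (fun x => a%:E * (a%:E * (f x * f x)%:E)
    + ((2 * a)%:E * (f x * g x)%:E + (g x * g x)%:E))%E); last first.
  apply/funext => x; rewrite -!EFinM -!EFinD; congr EFin.
  by rewrite !fctE /GRing.scale/=; ring.
have I u v := integrable_l2M (f := u) (g := v).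
by apply: integrableD => //; [do 2 apply: integrableZl => //; exact: I|
  apply: integrableD => //; [apply: integrableZl => //|]; exact: I].
Qed.

HB.instance Definition _ := GRing.isSubmodClosed.Build R (R -> R) l2 l2_submod_closed.

Record L2space := L2Space { L2val :> R -> R; L2valP : L2val \in l2 }.
HB.instance Definition _ := [isSub for L2val].
HB.instance Definition _ := [Choice of L2space by <:].
HB.instance Definition _ := [SubChoice_isSubLmodule of L2space by <:].
End square_integrable.

(** * Inner product of L^2 and invariance under translations *)

Section L2_inner_product.
Context {R : realType}.
Local Notation mu := (@lebesgue_measure R).
Implicit Types F G : L2space (R := R).

Lemma L2valD F G x : (F + G) x = F x + G x. Proof. by []. Qed.
Lemma L2valB F G x : (F - G) x = F x - G x. Proof. by []. Qed.
Lemma L2valZ a F x : (a *: F) x = a * F x. Proof. by []. Qed.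

Definition ip2 F G : R := \int[mu]_x (F x * G x).

Lemma integrable_L2M F G : mu.-integrable setT (fun x => (F x * G x)%:E).
Proof. by apply: integrable_l2M; exact: L2valP. Qed.

Lemma measurable_L2 F : measurable_fun setT F.
Proof. exact: l2_measurable (L2valP F). Qed.

Lemma ip2P : semi_inner ip2.
Proof.
split=> [F G|F G K|a F G|F].
- by apply: eq_Rintegral => x _; rewrite mulrC.
- rewrite /ip2 -RintegralD//; [|exact: integrable_L2M..].
  by apply: eq_Rintegral => x _; rewrite L2valD mulrDl.
- rewrite /ip2 -RintegralZl//; last exact: integrable_L2M.
  by apply: eq_Rintegral => x _; rewrite L2valZ mulrA.
- by apply: Rintegral_ge0 => x _; rewrite -expr2 sqr_ge0.
Qed.

Lemma ip2_ae_eq F F' G G' : ae_eq mu setT F F' -> ae_eq mu setT G G' ->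
  ip2 F G = ip2 F' G'.
Proof.
move=> FF' GG'; congr fine; apply: ae_eq_integral => //.
- by apply/measurable_EFinP/measurable_funM; exact: measurable_L2.
- by apply/measurable_EFinP/measurable_funM; exact: measurable_L2.
- by move: FF' GG'; apply: filterS2 => x Fx Gx xT; rewrite /= Fx// Gx.
Qed.

Definition translate (h : R) (x : measurableTypeR R) : measurableTypeR R := x + h.

Lemma measurable_shiftr (h : R) : measurable_fun setT (translate h).
Proof. exact: measurable_funD. Qed.

HB.instance Definition _ (h : R) :=
  isMeasurableFun.Build _ _ _ _ (translate h) (measurable_shiftr h).

Lemma lebesgue_measure_shift (h : R) (A : set R) : measurable A ->
  pushforward mu (translate h) A = mu A.
Proof.
move=> mA; apply/esym/lebesgue_measure_unique => //= _ [[a b]] _ <-.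
rewrite /pushforward (_ : _ @^-1` _ = `](a - h), (b - h)]%classic); last first.
  by apply/seteqP; split=> x /=; rewrite !in_itv/= ltrBlDr lerBrDr.
rewrite !lebesgue_measure_itv/= !lte_fin ltrD2r; case: ifP => // _.
by rewrite -!EFinB; congr EFin; ring.
Qed.

Lemma ge0_integral_shiftr (h : R) (f : R -> \bar R) : measurable_fun setT f ->
  (forall x, 0 <= f x)%E -> (\int[mu]_x f (x + h)%R = \int[mu]_x f x)%E.
Proof.
move=> mf f0.
rewrite [RHS](eq_measure_integral (pushforward mu (translate h))).
  by rewrite (ge0_integral_pushforward (measurable_shiftr h))// preimage_setT.
by move=> A mA _; exact/esym/lebesgue_measure_shift.
Qed.

Lemma integrable_shiftr (h : R) (f : R -> R) : mu.-integrable setT (EFin \o f) ->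
  mu.-integrable setT (fun x => (f (x + h))%:E).
Proof.
move=> /integrableP[mf fi]; apply/integrableP; split.
  exact: (measurableT_comp mf (measurable_shiftr h)).
by rewrite (ge0_integral_shiftr h (f := fun x => `|(f x)%:E|%E))//; exact: measurableT_comp.
Qed.

Lemma Rintegral_shiftr (h : R) (f : R -> R) : mu.-integrable setT (EFin \o f) ->
  \int[mu]_x f (x + h) = \int[mu]_x f x.
Proof.
move=> fi; congr fine.
rewrite [RHS](eq_measure_integral (pushforward mu (translate h))).
  rewrite (integral_pushforward (measurable_shiftr h))//.
    exact: measurable_int fi.
  by rewrite preimage_setT; exact: integrable_shiftr.
by move=> A mA _; exact/esym/lebesgue_measure_shift.
Qed.

Lemma l2_shift (h : R) F : (fun x => F (x + h)) \in l2.
Proof.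
apply/l2P; split; first exact: (measurableT_comp (measurable_L2 F) (measurable_shiftr h)).
by apply: (integrable_shiftr h (f := fun x => F x ^+ 2)); have /l2P[] := L2valP F.
Qed.

Definition shift2 (h : R) F := L2Space (l2_shift h F).

Lemma shift2_is_linear h : linear (shift2 h).
Proof. by move=> a F G; apply/val_inj. Qed.
HB.instance Definition _ h := GRing.isLinear.Build R L2space L2space _ (shift2 h) (shift2_is_linear h).

Lemma ip2_shift2 h F G : ip2 (shift2 h F) (shift2 h G) = ip2 F G.
Proof. exact: (Rintegral_shiftr h (f := fun x => F x * G x)) (integrable_L2M F G). Qed.

Lemma shift2D h k F : shift2 h (shift2 k F) = shift2 (h + k) F.
Proof. by apply/val_inj/funext => x /=; rewrite addrA. Qed.

Lemma shift20 F : shift2 0 F = F.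
Proof. by apply/val_inj/funext => x /=; rewrite addr0. Qed.

Lemma shift2K h F : shift2 h (shift2 (- h) F) = F.
Proof. by rewrite shift2D subrr shift20. Qed.

End L2_inner_product.

(** * Density of continuous compactly supported functions, continuity of translations in L^2 *)

Section L2_density.
Context {R : realType}.
Local Notation mu := (@lebesgue_measure R).
Local Notation n2 := (sinorm (@ip2 R)).
Implicit Types F G : L2space (R := R).

Lemma EFin_ip2 F : (ip2 F F)%:E = (\int[mu]_x ((F x) ^+ 2)%:E)%E.
Proof.
by rewrite /ip2 /Rintegral fineK// integrable_fin_num//; exact: integrable_L2M.
Qed.

Lemma sinorm_ip2_lt F e : 0 < e ->
  (\int[mu]_x ((F x) ^+ 2)%:E < (e ^+ 2)%:E)%E -> n2 F < e.
Proof.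
move=> e0; rewrite -EFin_ip2 lte_fin -(sqr_sinorm (@ip2P R)) => Fe.
by rewrite -(ltr_pXn2r (n := 2)) ?nnegrE ?sinorm_ge0// ltW.
Qed.

Lemma l2_bounded_support (f : R -> R) (B M : R) : measurable_fun setT f ->
  (forall x, `|f x| <= B) -> (forall x, M < `|x| -> f x = 0) -> f \in l2.
Proof.
move=> mf fB fM; apply/l2P; split=> //.
pose A : set (measurableTypeR R) := `[- M, M]%classic.
have mA : measurable A by exact: measurable_itv.
have Afin : (mu A < +oo)%E.
  by rewrite lebesgue_measure_itv; case: ifP => // _; rewrite -EFinB ltry.
rewrite (_ : (fun x => _) = (fun x => (f x ^+ 2)%:E) \_ A).
  apply: (iffLR (integrable_mkcond _ mA)).
    apply: (@measurable_bounded_integrable _ _ _ mu (fun x => f x ^+ 2) _ mA Afin).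
    by apply/measurable_funX; exact: measurable_funS mf.
  exists (B ^+ 2); split=> [|z Bz x _ /=]; first exact: num_real.
  rewrite normrX (le_trans _ (ltW Bz))// lerXn2r ?nnegrE//.
  exact: le_trans (fB x).
apply/funext => x; rewrite patchE; case: ifPn => // /negP xM.
rewrite fM ?expr0n// ltNge; apply/negP => xM'; apply: xM.
by rewrite inE /A /= in_itv/= -ler_norml.
Qed.

(** The same integer cuts off both the variable and the value. At every point the truncation is
    eventually exact, so dominated convergence applies. *)
Lemma L2_bounded_approx F e : 0 < e ->
  exists (G : L2space) (n : nat), n2 (F - G) < e /\
    forall x, `|G x| <= n%:R /\ (n%:R < `|x| -> G x = 0).
Proof.
move=> e0; have mF := measurable_L2 F.
pose A n : set R := `[- n%:R, n%:R]%classic `&` F @^-1` `[- n%:R, n%:R]%classic.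
have mA n : measurable (A n).
  apply: measurableI => //; rewrite -[X in measurable X]setTI; exact: mF.
have AP n x : A n x <-> `|x| <= n%:R /\ `|F x| <= n%:R.
  by rewrite /A /= !in_itv/= !ler_norml.
pose g n x := F x * \1_(A n) x.
have mg n : measurable_fun setT (g n) by exact: measurable_funM.
have gF n x : `|g n x| <= `|F x|.
  rewrite /g normrM indicE; case: (_ \in _); rewrite ?normr1 ?mulr1//.
  by rewrite normr0 mulr0.
have gl n : g n \in l2 by apply: l2_le (gF n) => //; exact: L2valP.
have gE x : \forall n \near \oo, g n x = F x.
  near=> n; rewrite /g indicE mem_set ?mulr1//; apply/AP.
  by split; near: n; exact: nbhs_infty_ger.
have [|||||_ _ cv] := @dominated_convergence _ _ _ mu setT measurableT
  (fun n x => ((F x - g n x) ^+ 2)%:E) (cst 0%E) (fun x => (4 * F x ^+ 2)%:E).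
- move=> n; apply/measurable_EFinP/measurable_funX; apply: measurable_funB; [exact: mF|exact: mg].
- exact: measurable_cst.
- apply: aeW => x _ /=; apply: cvg_near_cst; apply: filterS (gE x) => n ->.
  by rewrite subrr expr0n.
- under eq_fun do rewrite EFinM; apply: integrableZl => //.
  by have /l2P[] := L2valP F.
- apply: aeW => x n _; rewrite /= lee_fin ger0_norm ?sqr_ge0//.
  have : g n x ^+ 2 <= F x ^+ 2.
    rewrite -(real_normK (num_real (g n x))) -(real_normK (num_real (F x))).
    by rewrite lerXn2r ?nnegrE.
  have := sqr_ge0 (F x + g n x); lra.
move: cv; rewrite integral_cst// mul0e => /fine_cvgP[_].
move=> /cvgrPdist_lt/(_ _ (exprn_gt0 2 e0)) [n _ /(_ n (leqnn n))/=].
rewrite sub0r normrN => cvn; exists (L2Space (gl n)), n; split.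
  apply: sinorm_ip2_lt => //; rewrite -EFin_ip2 lte_fin.
  by apply: le_lt_trans cvn; rewrite (le_trans _ (ler_norm _)).
move=> x /=; rewrite /g indicE; have [/set_mem/AP[xn Fxn]|xA] := boolP (x \in A n).
  by rewrite mulr1; split=> //; rewrite ltNge xn.
by rewrite mulr0 normr0.
Unshelve. all: by end_near. Qed.

(** A bounded function supported in an interval is approximated by continuous ones in $L^1$.
    Clipping the approximant to the same bound turns the $L^1$ error into an $L^2$ error. *)
Lemma L2_continuous_approx F e : 0 < e ->
  exists (G : L2space) (M : R), [/\ n2 (F - G) < e, continuous G &
    forall x, M < `|x| -> G x = 0].
Proof.
move=> e0.
have [H [n [FH Hn]]] := L2_bounded_approx F (divr_gt0 e0 (ltr0n _ 2)).
(* One unit wider than the support of [H] on each side, leaving room for a continuous cutoff to fall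
   from 1 to 0. *)
pose E : set (measurableTypeR R) := `[- (n.+1)%:R, n.+1%:R]%classic.
have mE : measurable E by exact: measurable_itv.
have Efin : (mu E < +oo)%E by rewrite lebesgue_measure_itv; case: ifP => // _; rewrite -EFinB ltry.
have mH : measurable_fun setT H := measurable_L2 H.
have iH : mu.-integrable E (EFin \o H).
  apply: measurable_bounded_integrable => //; first exact: measurable_funS mH.
  exists n%:R; split=> [|M nM x _ /=]; first exact: num_real.
  by rewrite (le_trans (Hn x).1)// ltW.
have [g_ [gc _ cv]] := approximation_continuous_integrable mE Efin iH.
(* The final error is at most [2 * n%:R + 1] on [E], so its square is at most that number times the
   $L^1$ integrand. The added 1 keeps the divisor positive when [n] is 0. *)
have d0 : 0 < (e / 2) ^+ 2 / (2 * n%:R + 1) :> R.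
  by rewrite divr_gt0 ?exprn_gt0 ?divr_gt0// ltr_wpDl// mulr_ge0.
move/fine_cvgP : cv => [fn /cvgrPdist_lt/(_ _ d0)].
move=> /(filterI fn) [j _ /(_ j (leqnn j)) [/= gjfin]]; rewrite sub0r normrN.
set g := g_ j => gj.
(* [c] is the cutoff and [k] is [g] clipped to the range of [H]. Neither operation increases the
   distance to [H], since [H] is bounded by [n%:R] and vanishes where [c] differs from 1. *)
pose c (x : R) : R := Num.max 0 (Num.min 1 (n.+1%:R - `|x|)).
pose k (x : R) : R := Num.max (- n%:R) (Num.min n%:R (g x)).
have c01 x : 0 <= c x <= 1 by rewrite /c le_max lexx /= ge_max ler01 ge_min lexx.
have c1 x : `|x| <= n%:R -> c x = 1.
  move=> xn; rewrite /c (min_idPl _) ?(max_idPr _)//.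
  by rewrite lerBrDr -natr1 addrC lerD2r.
have c0 x : n.+1%:R <= `|x| -> c x = 0.
  by move=> xn; apply/max_idPl; rewrite ge_min subr_le0 xn orbT.
have kn x : `|k x| <= n%:R.
  rewrite ler_norml /k le_max lexx/= ge_max ge_min lexx/= andbT.
  by rewrite (@le_trans _ _ 0)// oppr_le0.
have kH x : `|H x - k x| <= `|H x - g x|.
  have := (Hn x).1; rewrite ler_norml /k => /andP[h1 h2].
  have [gn|gn] := leP (g x) n%:R; last first.
    by rewrite (max_idPr _) ?ler0_norm; lra.
  have [ng|gn'] := leP (- n%:R) (g x); first by [].
  by rewrite ?ger0_norm; lra.
pose psi x := c x * k x.
have psiH x : `|H x - psi x| <= `|H x - g x|.
  have [xn|xn] := leP `|x| n%:R; first by rewrite /psi c1// mul1r.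
  rewrite /psi (le_trans _ (kH x))// (Hn x).2// !sub0r !normrN normrM.
  by rewrite ler_piMl// ger0_norm; have /andP[] := c01 x.
have psic : continuous psi.
  move=> x; apply: continuousM.
    apply: continuous_max; first exact: cvg_cst.
    apply: continuous_min; first exact: cvg_cst.
    by apply: continuousB; [exact: cvg_cst|exact: norm_continuous].
  apply: continuous_max; first exact: cvg_cst.
  by apply: continuous_min; [exact: cvg_cst|exact: gc].
have psiM x : n.+1%:R < `|x| -> psi x = 0.
  by move=> xn; rewrite /psi c0 ?mul0r// ltW.
have psil2 : psi \in l2.
  apply: (@l2_bounded_support _ n%:R n.+1%:R) => //.
    exact: continuous_measurable_fun.
  move=> x; rewrite normrM (le_trans _ (kn x))// ler_piMl//.
  by rewrite ger0_norm; have /andP[] := c01 x.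
exists (L2Space psil2), n.+1%:R; split=> //.
rewrite (le_lt_trans (sinorm_triB (@ip2P R) _ H _))//.
rewrite [e]splitr ltrD//; apply: sinorm_ip2_lt; first by rewrite divr_gt0.
have mg : measurable_fun setT g by apply: continuous_measurable_fun; exact: gc.
pose w0 x := `|(H x - g x)%:E|%E.
have mw0 D : measurable_fun D w0.
  apply: measurable_funS measurableT _ _ => //.
  by apply: measurableT_comp => //; apply/measurable_EFinP/measurable_funB.
pose w x := ((2 * n%:R + 1)%:E * w0 x)%E.
have mw D : measurable_fun D w by exact: emeasurable_funM.
have Hw x : (((H x - psi x) ^+ 2)%:E <= (w \_ E) x)%E.
  rewrite patchE; case: ifPn => xE.
    rewrite /w -EFinM lee_fin -(real_normK (num_real (H x - psi x))) expr2.
    have b : `|H x - psi x| <= 2 * n%:R + 1.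
      rewrite (le_trans (ler_normB _ _))// mulr_natl mulr2n.
      have := (Hn x).1; have : `|psi x| <= n%:R; last by lra.
      rewrite normrM (le_trans _ (kn x))// ler_piMl//.
      by rewrite ger0_norm; have /andP[] := c01 x.
    by rewrite ler_pM.
  have xn : n.+1%:R < `|x|.
    rewrite ltNge; apply: contra xE => xn.
    by rewrite inE /E /= in_itv/= -ler_norml.
  rewrite (Hn x).2 ?psiM//; first by rewrite subr0 expr0n.
  by rewrite (lt_trans _ xn)// ltr_nat.
rewrite (@le_lt_trans _ _ (\int[mu]_(x in E) w x)%E)//.
  rewrite [leRHS]integral_mkcond; apply: ge0_le_integral => //.
  - by move=> x _; rewrite lee_fin sqr_ge0.
  - by apply/measurable_EFinP/measurable_funX; exact: measurable_L2.
  - exact: ((measurable_restrictT w mE).1 (mw E)).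
  - by move=> x _; exact: Hw.
have k0 : 0 <= 2 * n%:R + 1 :> R by rewrite addr_ge0// mulr_ge0.
rewrite /w (ge0_integralZl_EFin _ mE _ (mw0 E) k0)//; last by move=> x _; exact: abse_ge0.
rewrite -(fineK gjfin) -EFinM lte_fin mulrC -ltr_pdivlMr; last first.
  by rewrite ltr_wpDl// mulr_ge0.
exact: le_lt_trans (ler_norm _) gj.
Qed.

(** Reduction to sequences tending to 0. Domination is available only for steps of size at most 1,
    hence the shift of the index by [N]. *)
Lemma dominated_cvg_dnbhs (f : R -> R -> R) (g : R -> R) :
  (forall h, measurable_fun setT (f h)) ->
  (forall x, f h x @[h --> 0^'] --> 0) ->
  mu.-integrable setT (EFin \o g) ->
  (forall h x, `|h| <= 1 -> `|f h x| <= g x) ->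
  \int[mu]_x f h x @[h --> 0^'] --> 0.
Proof.
move=> mf f0 ig fg; apply/cvgr_dnbhsP => u [u0 uc].
have [N _ uN] : \forall n \near \oo, `|u n| <= 1.
  by have /cvgrPdist_le/(_ 1 ltr01) := uc; apply: filterS => n; rewrite sub0r normrN.
rewrite -(cvg_shiftn N).
have [|||||_ _ cv] := @dominated_convergence _ _ _ mu setT measurableT
  (fun n x => (f (u (n + N)%N) x)%:E) (cst 0%E) (EFin \o g).
- by move=> n; apply/measurable_EFinP; exact: mf.
- exact: measurable_cst.
- apply: aeW => x _ /=; apply: cvg_EFin; first by apply: nearW.
  have /cvgr_dnbhsP/(_ u (conj u0 uc)) := f0 x.
  by rewrite -(cvg_shiftn N).
- by [].
- apply: aeW => x n _; rewrite /= lee_fin; apply: fg.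
  by apply: uN; rewrite /= leq_addl.
move: cv; rewrite integral_cst// mul0e => /fine_cvgP[_].
exact.
Qed.

Local Notation tr := (@shift2 R).

Lemma sinorm_shift2 h F : n2 (tr h F) = n2 F.
Proof. by rewrite /sinorm ip2_shift2. Qed.

Lemma sinorm_ip2_cvg0 (X : Type) (Fl : set_system X) (FF : Filter Fl) (F : X -> L2space) :
  \int[mu]_x (F h x) ^+ 2 @[h --> Fl] --> 0 -> n2 (F h) @[h --> Fl] --> 0.
Proof.
move=> i0; rewrite -(sqrtr0 R).
exact: (@cvg_comp _ _ _ (fun h => ip2 (F h) (F h)) Num.sqrt _ _ _ i0
  (@sqrt_continuous R 0)).
Qed.

Lemma continuous_support_bounded (f : R -> R) (M : R) : continuous f ->
  (forall x, M < `|x| -> f x = 0) -> exists B, forall x, `|f x| <= B.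
Proof.
move=> fc fM; have cf : compact (f @` `[- M, M]%classic).
  by apply: continuous_compact; [exact: continuous_subspaceT|exact: segment_compact].
have [B [_ HB]] := compact_bounded cf.
exists (`|B| + 1) => x; have [xM|xM] := leP `|x| M; last first.
  by rewrite fM// normr0 addr_ge0.
apply: (HB (`|B| + 1)); first by rewrite (le_lt_trans (ler_norm _))// ltrDl.
by exists x => //=; rewrite in_itv/= -ler_norml.
Qed.

Lemma l2_continuous_support (f : R -> R) (M : R) : continuous f ->
  (forall x, M < `|x| -> f x = 0) -> f \in l2.
Proof.
move=> fc fM; have [B fB] := continuous_support_bounded fc fM.
by apply: l2_bounded_support fB fM; exact: continuous_measurable_fun.
Qed.

Lemma dominated_L2_cvg0 (F : R -> L2space) (B M : R) :
  (forall x, F h x @[h --> 0^'] --> 0) ->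
  (forall h x, `|h| <= 1 -> `|F h x| <= B) ->
  (forall h x, `|h| <= 1 -> M < `|x| -> F h x = 0) ->
  n2 (F h) @[h --> 0^'] --> 0.
Proof.
move=> F0 FB FM.
pose I : set (measurableTypeR R) := `[- M, M]%classic.
have mI : measurable I by exact: measurable_itv.
apply: sinorm_ip2_cvg0.
apply: (dominated_cvg_dnbhs (g := fun x => B ^+ 2 * \1_I x)).
- by move=> h; apply: measurable_funX; exact: measurable_L2.
- by move=> x; have := cvgM (F0 x) (F0 x); rewrite mul0r => cc; exact: cc.
- rewrite (_ : _ \o _ = fun x => (B ^+ 2)%:E * (\1_I x)%:E)%E//.
  apply: integrableZl => //; exact: integrable_indic_itv.
- move=> h x h1; rewrite normrX /= indicE.
  case: (boolP (x \in I)) => xI.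
    by rewrite mulr1 lerXn2r ?nnegrE// ?FB// (le_trans _ (FB h x h1)).
  rewrite mulr0 FM ?normr0 ?expr0n// ltNge; apply: contra xI => xM.
  by rewrite inE /I /= in_itv/= -ler_norml.
Qed.

(** For a continuous compactly supported function this is dominated convergence; translations being
    isometries, density extends it to $L^2$. *)
Lemma shift2_cvg F : n2 (tr h F - F) @[h --> 0^'] --> 0.
Proof.
apply/cvgrPdist_le => e e0.
have e3 : 0 < e / 3 by rewrite divr_gt0.
have [G [M [FG Gc GM]]] := L2_continuous_approx F e3.
have Gcv : n2 (tr h G - G) @[h --> 0^'] --> 0.
  have [B GB] := continuous_support_bounded Gc GM.
  apply: (@dominated_L2_cvg0 _ (2 * B) (M + 1)).
  - move=> x; apply: cvg_within_filter.
    apply/subr_cvg0; apply: (@cvg_comp _ _ _ (fun h => x + h) G _ (nbhs x)); last exact: Gc.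
    by rewrite -{2}(addr0 x); apply: cvgD; [exact: cvg_cst|exact: cvg_id].
  - move=> h x h1; rewrite L2valB (le_trans (ler_normB _ _))// mulr_natl mulr2n.
    by apply: lerD; exact: GB.
  - move=> h x h1 xM; rewrite L2valB.
    have hx : `|x| <= `|x + h| + `|h| by rewrite -{1}(addrK h x) ler_normB.
    by rewrite /= (GM x) ?(GM (x + h)) ?subrr//; lra.
have /cvgrPdist_le/(_ _ e3) := Gcv; apply: filterS => h.
rewrite !sub0r !normrN !ger0_norm ?sinorm_ge0// => Ge.
have -> : tr h F - F = tr h (F - G) + (tr h G - G) - (F - G).
  by rewrite raddfB addrA subrK opprB addrA subrK.
have hP := @ip2P R.
apply: le_trans (sinormB hP _ _) _.
apply: le_trans (lerD (sinormD hP _ _) (lexx _)) _; rewrite sinorm_shift2.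
by move: FG Ge; move: (n2 (F - G)) (n2 (tr h G - G)) => a b; lra.
Qed.
End L2_density.

(** * Weak derivatives as limits of difference quotients in L^2 *)

Section weak_derivative_L2.
Context {R : realType}.
Local Notation mu := (@lebesgue_measure R).
Local Notation ip := (@ip2 R).
Local Notation n2 := (sinorm (@ip2 R)).
Local Notation tr := (@shift2 R).
Implicit Types F G : L2space (R := R).

Lemma test_function_continuous (phi : R -> R) :
  test_function phi -> continuous phi.
Proof.
move=> [phid _ _] x; apply: differentiable_continuous; exact/derivable1_diffP.
Qed.

Lemma test_function_l2 (phi : R -> R) : test_function phi -> phi \in l2.
Proof.
move=> tphi; have [_ _ [M phiM]] := tphi.
exact: l2_continuous_support (test_function_continuous tphi) phiM.
Qed.

Lemma derive1_support (phi : R -> R) (M : R) : (forall x, M < `|x| -> phi x = 0) ->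
  forall x, M < `|x| -> derive1 phi x = 0.
Proof.
move=> phiM x Mx; rewrite derive1E (near_eq_derive _ (g := cst 0)) ?derive_cst//.
have : \forall y \near x, M < `|y|.
  by have /cvgr_gt := @norm_continuous R R x; exact.
by apply: filterS => y; exact: phiM.
Qed.

Lemma test_derive1_l2 (phi : R -> R) : test_function phi -> derive1 phi \in l2.
Proof.
move=> [_ phic [M phiM]].
exact: l2_continuous_support phic (derive1_support phiM).
Qed.

Definition test_L2 (phi : R -> R) (t : test_function phi) := L2Space (test_function_l2 t).
Definition test_derive_L2 (phi : R -> R) (t : test_function phi) := L2Space (test_derive1_l2 t).

Definition diffq (h : R) F := h^-1 *: (tr h F - F).
(** The strong derivative in $L^2$. It is the working notion of derivative from here on, and
    [weak_sderiv] together with [sderiv_weak] identifies it with the weak one. *)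
Definition sderiv F G : Prop := n2 (diffq h F - G) @[h --> 0^'] --> 0.

Lemma derivable_MVT (f df : R -> R) (x y : R) : (forall z : R, is_derive z 1 f (df z)) ->
  exists2 c, `|c - x| <= `|y - x| & f y - f x = df c * (y - x).
Proof.
move=> fdf.
have wlg (a b : R) : a <= b ->
    exists2 c, a <= c <= b & f b - f a = df c * (b - a).
  move=> ab; have [|c cab e] := @MVT_segment R f df a b ab (fun z _ => fdf z).
    by apply: derivable_within_continuous => z _; have [] := fdf z.
  by exists c => //; move: cab; rewrite in_itv.
have [xy|/ltW yx] := leP x y.
  have [c cxy e] := wlg _ _ xy; exists c => //.
  by rewrite !ger0_norm; lra.
have [c cxy e] := wlg _ _ yx; exists c.
  by rewrite !ler0_norm; lra.
by rewrite -opprB e -mulrN opprB.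
Qed.

Lemma test_is_derive (phi : R -> R) : test_function phi ->
  forall z : R, is_derive z 1 phi (derive1 phi z).
Proof. by move=> [phid _ _] z; rewrite derive1E; exact: derivableP. Qed.

Lemma is_derive_diffquot (f : R -> R) (x d : R) : is_derive x 1 f d ->
  h^-1 * (f (x + h) - f x) @[h --> 0^'] --> d.
Proof.
move=> [fx <-].
have H : h^-1 *: (f (h *: 1 + x) - f x) @[h --> 0^'] --> 'D_1 f x := fx.
rewrite (_ : (fun h => _) = (fun h => h^-1 *: (f (h *: 1 + x) - f x)))//.
by apply/funext => h; rewrite [_ *: 1]mulr1 (addrC x).
Qed.

Lemma test_sderiv (phi : R -> R) (t : test_function phi) :
  sderiv (test_L2 t) (test_derive_L2 t).
Proof.
have [phid phic [M phiM]] := t.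
have [B phiB] := continuous_support_bounded phic (derive1_support phiM).
have B0 : 0 <= B := le_trans (normr_ge0 _) (phiB 0).
apply: (@dominated_L2_cvg0 _ _ (2 * B) (M + 1)).
- move=> x; rewrite /diffq.
  under eq_fun do rewrite L2valB L2valZ L2valB /=.
  by apply/subr_cvg0; apply: is_derive_diffquot; exact: test_is_derive.
- move=> h x h1; rewrite /diffq L2valB L2valZ L2valB /=.
  rewrite (le_trans (ler_normB _ _))// mulr_natl mulr2n lerD ?phiB//.
  have [c _ ->] := derivable_MVT x (x + h) (test_is_derive t).
  rewrite addrAC subrr add0r; have [->|h0] := eqVneq h 0.
    by rewrite invr0 mul0r normr0.
  by rewrite mulrCA mulVf// mulr1 phiB.
- move=> h x h1 xM; rewrite /diffq L2valB L2valZ L2valB /=.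
  have hx : `|x| <= `|x + h| + `|h| by rewrite -{1}(addrK h x) ler_normB.
  have xM' : M < `|x| by lra.
  have xhM : M < `|x + h| by lra.
  by rewrite (derive1_support phiM xM') (phiM _ xhM) (phiM _ xM') !subr0 mulr0.
Qed.

Definition weak_derivative_L2 F G : Prop :=
  forall phi (t : test_function phi), ip F (test_derive_L2 t) = - ip G (test_L2 t).

Lemma ip2_diffq h F G : ip (diffq h F) G = - ip F (diffq (- h) G).
Proof.
have hP := @ip2P R.
rewrite /diffq (sipZl hP) (sipZr hP) !(sipBl hP) !(sipBr hP) invrN mulNr opprK.
congr (_ * (_ - _)).
by rewrite -(ip2_shift2 (- h)) shift2D addNr shift20.
Qed.

(** Integration by parts in the limit: the adjoint of the difference quotient of step [h] is minus
    that of step [- h]. *)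
Lemma sderiv_ip2N F G H K : sderiv F G -> sderiv H K -> ip F K = - ip G H.
Proof.
move=> FG HK; have hP := @ip2P R.
have c1 : ip (diffq h F) H @[h --> 0^'] --> ip G H.
  by apply: (sip_cvg hP); [exact: FG|exact: sicvg_cst].
have c2 : - ip F (diffq (- h) H) @[h --> 0^'] --> - ip F K.
  apply: cvgN; apply: (sip_cvg hP); first exact: sicvg_cst.
  apply: (sicvg_comp (g := -%R) _ HK).
  move=> A /nbhs_ballP[e /= e0 eA]; apply/nbhs_ballP; exists e => //= h.
  rewrite /ball/= sub0r normrN => he h0; apply: eA; last by rewrite oppr_eq0.
  by rewrite /ball/= sub0r opprK.
apply/eqP; rewrite -eqr_oppLR; apply/eqP.
apply: (cvg_unique _ c2); first exact: norm_hausdorff.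
rewrite (_ : (fun h => _) = (fun h => ip (diffq h F) H)); first exact: c1.
by apply/funext => h; rewrite ip2_diffq.
Qed.

Lemma primitive_exists (f : R -> R) (M : R) : continuous f ->
  (forall x, M < `|x| -> f x = 0) -> exists P : R -> R, forall x : R, is_derive x 1 P (f x).
Proof.
move=> fc fM; pose P x := \int[mu]_(t in `]-oo, x]) f t.
have fi : mu.-integrable setT (EFin \o f).
  pose A : set (measurableTypeR R) := `[- M, M]%classic.
  have mA : measurable A by exact: measurable_itv.
  have Afin : (mu A < +oo)%E.
    by rewrite lebesgue_measure_itv; case: ifP => // _; rewrite -EFinB ltry.
  rewrite (_ : (EFin \o f) = (EFin \o f) \_ A).
    apply: (iffLR (integrable_mkcond _ mA)).
    apply: (@measurable_bounded_integrable _ _ _ mu f _ mA Afin).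
      apply: measurable_funS measurableT _ _ => //.
      exact: continuous_measurable_fun.
    have [B fB] := continuous_support_bounded fc fM.
    by exists B; split=> [|z Bz x _ /=]; [exact: num_real|exact: le_trans (ltW Bz)].
  apply/funext => x; rewrite patchE; case: ifPn => // /negP xM /=.
  rewrite fM// ltNge; apply/negP => xM'; apply: xM.
  by rewrite inE /A /= in_itv/= -ler_norml.
exists P => x.
have fix_ : mu.-integrable `]-oo, (x + 1)] (EFin \o f).
  exact: integrableS measurableT _ _ fi.
have xu : x < x + 1 by rewrite ltrDl.
have [|Pd PE] := @continuous_FTC1 R f -oo%O x (x + 1) xu fix_ _ (fc x).
  by rewrite ltNyr.
by apply: DeriveDef; [exact: Pd|rewrite -derive1E; exact: PE].
Qed.

Lemma L2_test_approx F e : 0 < e ->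
  exists phi (t : test_function phi), n2 (F - test_L2 t) < e.
Proof.
move=> e0; have e2 : 0 < e / 2 by rewrite divr_gt0.
have [G [M [FG Gc GM]]] := L2_continuous_approx F e2.
have [P PG] := primitive_exists Gc GM.
have [B GB] := continuous_support_bounded Gc GM.
(* Steklov averages of [G] are of class C^1. *)
pose psi h x := h^-1 * (P (x + h) - P x).
have PP (h x : R) : is_derive x 1 (fun x => P (x + h)) (G (x + h)).
  have g1 : is_derive x 1 (fun x : R => x + h) 1 by exact: is_derive_shift.
  by have := @is_derive1_comp R P (fun x : R => x + h) x _ _ (PG (x + h)) g1; rewrite mulr1.
have psi' (h x : R) : is_derive x 1 (psi h) (h^-1 * (G (x + h) - G x)).
  by have := @is_deriveZ _ _ _ (fun x => P (x + h) - P x) h^-1 x 1 _ (is_deriveB (PP h x) (PG x)).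
have psid h : derive1 (psi h) = fun x => h^-1 * (G (x + h) - G x).
  by apply/funext => x; rewrite derive1E; have [] := psi' h x.
(* By the mean value theorem [psi h x] is a value of [G] at distance at most the size of [h] from
   [x], so the support grows by no more than that. *)
have psiM (h x : R) : M + `|h| < `|x| -> psi h x = 0.
  move=> xM; rewrite /psi; have [c cx ->] := derivable_MVT x (x + h) PG.
  rewrite GM ?mul0r ?mulr0//; move: cx; rewrite (addrC x) addrK.
  have := ler_normD (c - x) (- c); rewrite addrAC subrr add0r normrN normrN; lra.
have t h : test_function (psi h).
  split; first by move=> x; have [] := psi' h x.
    rewrite psid => x; apply: cvgM; first exact: cvg_cst.
    apply: cvgB; last exact: Gc.
    apply: (@cvg_comp _ _ _ (fun x => x + h) G _ (nbhs (x + h))); last exact: Gc.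
    by apply: cvgD => //; exact: cvg_cst.
  by exists (M + `|h|); exact: psiM.
have : n2 (G - test_L2 (t h)) @[h --> 0^'] --> 0.
  apply: (@dominated_L2_cvg0 _ _ (2 * B) (M + 1)).
  - move=> x; have : psi h x - G x @[h --> 0^'] --> 0.
      by apply/subr_cvg0; exact: is_derive_diffquot.
    move=> /cvgN; rewrite oppr0; apply: cvg_trans; apply: near_eq_cvg.
    by apply: nearW => h; rewrite !fctE opprB.
  - move=> h x h1; rewrite L2valB (le_trans (ler_normB _ _))// mulr_natl mulr2n.
    apply: lerD; first exact: GB.
    have [c _] := derivable_MVT x (x + h) PG.
    rewrite /= /psi (addrC x) addrK => ->; have [->|h0] := eqVneq h 0.
      by rewrite invr0 mul0r normr0 (le_trans _ (GB 0)).
    by rewrite mulrCA mulVf// mulr1.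
  - move=> h x h1 xM; rewrite L2valB /= psiM ?GM ?subr0//; first by lra.
    by rewrite (le_lt_trans _ xM)// lerD2l.
move=> /cvgrPdist_lt/(_ _ e2) H; near (0 : R)^' => h.
exists (psi h), (t h).
rewrite (le_lt_trans (sinorm_triB (@ip2P R) _ G _))// [e]splitr ltrD//.
rewrite (le_lt_trans (ler_norm _))// -normrN -sub0r; near: h; exact: H.
Unshelve. all: by end_near. Qed.

(** Density of test functions lets them compute the norm by duality. This converts estimates on weak
    pairings into norm estimates. *)
Lemma L2_dual_le F c : 0 <= c ->
  (forall phi (t : test_function phi), `|ip F (test_L2 t)| <= c * n2 (test_L2 t)) ->
  n2 F <= c.
Proof.
move=> c0 Fc; rewrite leNgt; apply/negP => cF.
have hP := @ip2P R.
have F0 : 0 < n2 F := le_lt_trans c0 cF.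
(* A test function within [e] of [F] would give [n2 F * (n2 F - c) <= e * (n2 F + c)]. This choice
   makes the right side half of the left, which is positive. *)
pose e := n2 F * (n2 F - c) / (2 * (n2 F + c)).
have Fc0 : 0 < n2 F + c by rewrite ltr_wpDr.
have e0 : 0 < e by rewrite divr_gt0 ?mulr_gt0// subr_gt0.
have [phi [t Ft]] := L2_test_approx F e0.
have := Fc _ t; have := sip_le hP F (F - test_L2 t).
have := sinormB hP F (F - test_L2 t); rewrite opprB addrC subrK.
have := sqr_sinorm hP F; rewrite (sipBr hP).
have : n2 F * (n2 F - c) = 2 * e * (n2 F + c).
  by rewrite /e; field; rewrite gt_eqF.
have := ler_norm (ip F F - ip F (test_L2 t)); have := ler_norm (ip F (test_L2 t)).
move: Ft F0 c0 cF e0 {Fc Fc0}.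
move: (ip F F) (ip F (test_L2 t)) (n2 F) (n2 (F - test_L2 t)) (n2 (test_L2 t)).
clearbody e => a b x d y de x0 c0 cx e0 ab b1 xe xa yx a1 bc.
have h1 : c * y <= c * (x + d) by rewrite ler_wpM2l.
have h2 : d * (x + c) < e * (x + c) by rewrite ltr_pM2r// ltr_wpDr.
have h3 : 0 < e * (x + c) by rewrite mulr_gt0// ltr_wpDr.
lra.
Qed.
End weak_derivative_L2.

(** * Equivalence of weak and strong derivatives *)

Section weak_strong_derivative.
Context {R : realType}.
Local Notation mu := (@lebesgue_measure R).
Local Notation ip := (@ip2 R).
Local Notation n2 := (sinorm (@ip2 R)).
Local Notation tr := (@shift2 R).
Implicit Types F G : L2space (R := R).
Let ipP := @ip2P R.

Lemma diffquot_is_derive (f : R -> R) (x d : R) :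
  h^-1 * (f (x + h) - f x) @[h --> 0^'] --> d -> is_derive x 1 f d.
Proof.
move=> fd; have H : h^-1 *: (f (h *: 1 + x) - f x) @[h --> 0^'] --> d.
  rewrite (_ : (fun h => _) = (fun h => h^-1 * (f (x + h) - f x)))//.
  by apply/funext => h; rewrite [_ *: 1]mulr1 (addrC x).
by apply: DeriveDef; [apply/cvg_ex; exists d|exact/cvg_lim].
Qed.

Section shifted_test_function.
Variables (phi : R -> R) (t : test_function phi) (s : R).

Let shift_derive (x : R) : is_derive x 1 (fun x => phi (x + s)) (derive1 phi (x + s)).
Proof.
have g1 : is_derive x 1 (fun x : R => x + s) 1 by exact: is_derive_shift.
have := @is_derive1_comp R phi (fun x : R => x + s) x _ _ (test_is_derive t (x + s)) g1.
by rewrite mulr1.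
Qed.

Lemma derive1_shift : derive1 (fun x => phi (x + s)) = fun x => derive1 phi (x + s).
Proof. by apply/funext => x; rewrite [LHS]derive1E; have [] := shift_derive x. Qed.

Lemma test_function_shift : test_function (fun x => phi (x + s)).
Proof.
have [_ phic [M phiM]] := t; split; first by move=> x; have [] := shift_derive x.
  rewrite derive1_shift => x.
  apply: (@cvg_comp _ _ _ (fun x => x + s) (derive1 phi) _ (nbhs (x + s))); last exact: phic.
  by apply: cvgD => //; exact: cvg_cst.
exists (M + `|s|) => x xM; apply: phiM.
have : `|x| <= `|x + s| + `|s| by rewrite -{1}(addrK s x) ler_normB.
lra.
Qed.

Lemma test_L2_shift : test_L2 test_function_shift = tr s (test_L2 t).
Proof. by apply/val_inj. Qed.

Lemma test_derive_L2_shift :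
  test_derive_L2 test_function_shift = tr s (test_derive_L2 t).
Proof. by apply/val_inj; rewrite /= derive1_shift. Qed.

End shifted_test_function.

Lemma ip2_shift2l s F G : ip (tr s F) G = ip F (tr (- s) G).
Proof. by rewrite -(ip2_shift2 (- s)) shift2D addNr shift20. Qed.

(** Moving the translation onto the test function makes [ip (tr s F) (test_L2 t)] differentiable in
    [s], with derivative [ip (tr s G) (test_L2 t)]. The intermediate point depends on the test
    function, but its bound does not. *)
Lemma weak_derivative_MVT F G : weak_derivative_L2 F G ->
  forall h phi (t : test_function phi), exists2 s, `|s| <= `|h| &
  ip (tr h F - F) (test_L2 t) = ip (tr s G) (test_L2 t) * h.
Proof.
move=> FG h phi t; set K := test_L2 t.
have a' (s : R) : is_derive s 1 (fun s => ip (tr s F) K) (ip (tr s G) K).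
  apply: diffquot_is_derive.
  have -> : ip (tr s G) K = - ip (tr s F) (test_derive_L2 t).
    rewrite !ip2_shift2l -(test_L2_shift t) -(test_derive_L2_shift t).
    by rewrite FG opprK.
  rewrite (_ : (fun h => _) = (fun h => - ip (tr s F) (diffq (- h) K))); last first.
    apply/funext => k; rewrite -ip2_diffq /diffq (sipZl ipP) (sipBl ipP).
    by rewrite shift2D (addrC k).
  apply: cvgN; apply: (sip_cvg ipP); first exact: sicvg_cst.
  apply: (sicvg_comp (g := -%R) _ (test_sderiv t)).
  move=> A /nbhs_ballP[e /= e0 eA]; apply/nbhs_ballP; exists e => //= k.
  rewrite /ball/= sub0r normrN => ke k0; apply: eA; last by rewrite oppr_eq0.
  by rewrite /ball/= sub0r opprK.
have [s] := derivable_MVT 0 h a'; rewrite !subr0 => sh e; exists s => //.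
by rewrite (sipBl ipP) -e shift20.
Qed.

Lemma sderiv_weak F G : sderiv F G -> weak_derivative_L2 F G.
Proof. by move=> FG phi t; exact: sderiv_ip2N FG (test_sderiv t). Qed.

(** Tested against any function, [diffq h F - G] equals [tr s G - G] for some [s] no larger than
    [h]. Continuity of translations makes the latter uniformly small, and [L2_dual_le] concludes. *)
Lemma weak_sderiv F G : weak_derivative_L2 F G -> sderiv F G.
Proof.
move=> FG; apply/cvgrPdist_le => e e0.
have /cvgrPdist_le/(_ e e0)/nbhs_ballP[r /= r0 rG] := shift2_cvg G.
have {}rG s : `|s| < r -> n2 (tr s G - G) <= e.
  move=> sr; have [->|s0] := eqVneq s 0.
    by rewrite shift20 subrr (sinorm0 ipP) ltW.
  have := rG s; rewrite /ball/= sub0r !normrN sub0r normrN => /(_ sr s0).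
  by rewrite ger0_norm ?sinorm_ge0.
apply/nbhs_ballP; exists r => //= h; rewrite /ball/= sub0r normrN => hr h0.
rewrite sub0r normrN ger0_norm ?sinorm_ge0//.
apply: L2_dual_le => [|phi t]; first exact: ltW.
have [s sh E] := weak_derivative_MVT FG h t.
have -> : ip (diffq h F - G) (test_L2 t) = ip (tr s G - G) (test_L2 t).
  by rewrite !(sipBl ipP) (sipZl ipP) E mulrC mulfK.
rewrite (le_trans (sip_le ipP _ _))// ler_wpM2r ?sinorm_ge0//.
by apply: rG; exact: le_lt_trans hr.
Qed.

Lemma sderiv_lip F G h : sderiv F G -> n2 (tr h F - F) <= `|h| * n2 G.
Proof.
move=> /sderiv_weak FG.
apply: L2_dual_le => [|phi t]; first by rewrite mulr_ge0 ?sinorm_ge0.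
have [s _ ->] := weak_derivative_MVT FG h t.
rewrite normrM mulrC -mulrA ler_wpM2l// -(sinorm_shift2 s G).
exact: sip_le.
Qed.

Lemma sderiv_unique F G G' : sderiv F G -> sderiv F G' -> n2 (G - G') = 0.
Proof.
move=> FG FG'; apply/eqP; rewrite eq_le sinorm_ge0 andbT.
have c : n2 (diffq h F - G) + n2 (diffq h F - G') @[h --> 0^'] --> (0 : R).
  by have := cvgD FG FG'; rewrite addr0 => c; exact: c.
apply: (cvgr_to_ge c); apply: nearW => h.
by rewrite (le_trans (sinorm_triB ipP _ (diffq h F) _))// (sinorm_distC ipP G).
Qed.

Lemma diffqD h F G : diffq h (F + G) = diffq h F + diffq h G.
Proof.
by rewrite /diffq (raddfD (tr h)) (opprD F) (addrACA (tr h F)) scalerDr.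
Qed.

Lemma diffqZ h a F : diffq h (a *: F) = a *: diffq h F.
Proof.
have trZ : tr h (a *: F) = a *: tr h F by exact: linearZ.
by rewrite /diffq trZ -scalerBr !scalerA mulrC.
Qed.

Lemma sderivD F F' G G' : sderiv F F' -> sderiv G G' -> sderiv (F + G) (F' + G').
Proof.
move=> FF GG.
have H : sicvg ip 0^' (fun h => diffq h F + diffq h G) (F' + G') by exact: sicvgD.
apply: (cvg_trans _ H); apply: near_eq_cvg; apply: nearW => h /=.
by rewrite diffqD.
Qed.

Lemma sderivZ a F F' : sderiv F F' -> sderiv (a *: F) (a *: F').
Proof.
move=> FF; have H : sicvg ip 0^' (fun h => a *: diffq h F) (a *: F') by exact: sicvgZ.
apply: (cvg_trans _ H); apply: near_eq_cvg; apply: nearW => h /=.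
by rewrite diffqZ.
Qed.

Lemma diffq_shift s h F : diffq h (tr s F) = tr s (diffq h F).
Proof. have trZ a K : tr s (a *: K) = a *: tr s K by exact: linearZ.
by rewrite /diffq trZ (raddfB (tr s)) /= !shift2D (addrC h). Qed.

Lemma sderiv_shift s F F' : sderiv F F' -> sderiv (tr s F) (tr s F').
Proof.
move=> FF; apply: (cvg_trans _ FF); apply: near_eq_cvg; apply: nearW => h /=.
by rewrite diffq_shift -(raddfB (tr s)) sinorm_shift2.
Qed.

End weak_strong_derivative.

(** * Sobolev bound and products in H^1 *)

Section sobolev_sup_bound.
Context {R : realType}.
Local Notation mu := (@lebesgue_measure R).
Local Notation ip := (@ip2 R).
Local Notation n2 := (sinorm (@ip2 R)).
Local Notation tr := (@shift2 R).
Implicit Types F G K : L2space (R := R).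
Let ipP := @ip2P R.

Lemma sinorm_ip2_le F G c : 0 <= c ->
  {ae mu, forall x, `|F x| <= c * `|G x|} -> n2 F <= c * n2 G.
Proof.
move=> c0 FG.
rewrite -(ger0_norm c0) -(sinormZ ipP) ler_wsqrtr// -lee_fin !EFin_ip2.
apply: ae_ge0_le_integral => //.
- by move=> x _; rewrite lee_fin sqr_ge0.
- by apply/measurable_EFinP/measurable_funX; exact: measurable_L2.
- by move=> x _; rewrite lee_fin sqr_ge0.
- by apply/measurable_EFinP/measurable_funX; exact: measurable_L2.
move: FG; apply: filterS; first exact: (ae_filter_ringOfSetsType mu).
move=> x FGx _; rewrite lee_fin L2valZ exprMn.
rewrite -(real_normK (num_real (F x))) -(real_normK (num_real (G x))) -exprMn.
by rewrite lerXn2r ?nnegrE// mulr_ge0.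
Qed.

Lemma l2_restrict F (A : set (measurableTypeR R)) : measurable A ->
  (fun x => F x * \1_A x) \in l2.
Proof.
move=> mA; apply: (@l2_le _ _ F); [|exact: L2valP|].
  by apply: measurable_funM; [exact: measurable_L2|exact: measurable_indic].
move=> x; rewrite normrM indicE; case: (_ \in _); rewrite ?normr1 ?mulr1//.
by rewrite normr0 mulr0.
Qed.

Lemma sinorm_restrict_le F (A : set (measurableTypeR R)) (mA : measurable A) :
  n2 (L2Space (l2_restrict F mA)) <= n2 F.
Proof.
rewrite ler_wsqrtr// le_Rintegral//; try exact: integrable_L2M.
move=> x _ /=; rewrite indicE; case: (_ \in _); rewrite ?mulr1// !mulr0.
by rewrite -expr2 sqr_ge0.
Qed.

(* With [Q = F^2], translation turns the left-hand side into the integral of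
   [Q (. + k) - Q = (F (. + k) - F) (F (. + k) + F)] over ]-oo, x]. *)
Lemma ftc_shift_bound F G (k x : R) : sderiv F G ->
  \int[mu]_(t in `]-oo, (x + k)]) (F t) ^+ 2 - \int[mu]_(t in `]-oo, x]) (F t) ^+ 2
    <= `|k| * (2 * n2 F * n2 G).
Proof.
move=> FG; pose P y := \int[mu]_(t in `]-oo, y]) (F t) ^+ 2.
rewrite -/(P x) -/(P (x + k)); pose A : set (measurableTypeR R) := `]-oo, x]%classic.
have mA : measurable A by exact: measurable_itv.
have PE y : P y = \int[mu]_t (F t ^+ 2 * \1_(`]-oo, y]%classic : set R) t).
  rewrite /P Rintegral_mkcond; apply: eq_Rintegral => t _.
  by rewrite patchE indicE; case: (_ \in _); rewrite ?mulr1 ?mulr0.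
have PkE : P (x + k) = \int[mu]_t ((tr k F t) * (L2Space (l2_restrict (tr k F) mA)) t).
  rewrite PE -(Rintegral_shiftr k).
    apply: eq_Rintegral => t _ /=; rewrite expr2 mulrA; congr (_ * _).
    by rewrite !indicE /A !mem_setE /= !in_itv/= lerD2r.
  have mk : measurable (`]-oo, (x + k)]%classic : set (measurableTypeR R)).
    exact: measurable_itv.
  rewrite (_ : _ \o _ = fun t => (F t * (L2Space (l2_restrict F mk)) t)%:E).
    exact: integrable_L2M.
  by apply/funext => t /=; rewrite mulrA.
have PxE : P x = ip F (L2Space (l2_restrict F mA)).
  by rewrite PE; apply: eq_Rintegral => t _ /=; rewrite mulrA.
have -> : P (x + k) - P x = ip (tr k F - F) (L2Space (l2_restrict (tr k F + F) mA)).
  rewrite PkE PxE /ip2 -RintegralB//; try exact: integrable_L2M.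
  by apply: eq_Rintegral => t _ /=; rewrite !fctE; ring.
rewrite (le_trans (ler_norm _))// (le_trans (sip_le ipP _ _))//.
rewrite (le_trans (ler_pM _ _ (sderiv_lip k FG) (sinorm_restrict_le _ mA))) ?sinorm_ge0//.
have h := sinormD ipP (tr k F) F; rewrite sinorm_shift2 in h.
rewrite -!mulrA ler_wpM2l// [leRHS]mulrA [leRHS]mulrC ler_wpM2l ?sinorm_ge0//.
by rewrite mulr_natl mulr2n.
Qed.

(** Lebesgue differentiation: almost everywhere [F x ^+ 2] is the derivative of its own primitive,
    whose increments [ftc_shift_bound] controls linearly in the step. *)
Lemma sobolev_sup F G : sderiv F G ->
  {ae mu, forall x, F x ^+ 2 <= 2 * n2 F * n2 G}.
Proof.
move=> FG; pose Q x := F x ^+ 2.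
have Qi : mu.-integrable setT (EFin \o Q) by have /l2P[] := L2valP F.
have := @FTC1Ny R Q.
have Qiy y : mu.-integrable `]-oo, y] (EFin \o Q).
  exact: integrableS measurableT _ _ Qi.
move=> /(_ Qiy) /(_ (open_integrable_locally openT Qi)).
apply: filterS; first exact: (ae_filter_ringOfSetsType mu).
move=> x [Pd PQ]; rewrite -[leLHS]PQ.
set P := (f in derivable f) in Pd PQ *.
have Pc : h^-1 * (P (x + h) - P x) @[h --> 0^'] --> derive1 P x.
  by apply: is_derive_diffquot; rewrite derive1E; exact: derivableP.
have Pr : h^-1 * (P (x + h) - P x) @[h --> 0^'+] --> derive1 P x.
  exact: cvg_dnbhs_at_right.
apply: (cvgr_to_le Pr); near=> h.
have h0 : 0 < h by near: h; exact: nbhs_right_gt.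
rewrite ler_pdivrMl//.
have := @ftc_shift_bound F G h x FG.
by rewrite gtr0_norm.
Unshelve. all: by end_near. Qed.

(** An upper bound for the essential supremum, used in its place: being built from $L^2$ norms, it
    inherits their behaviour under translation. *)
Definition supb F G := Num.sqrt (2 * n2 F * n2 G).

Lemma sobolev_sup_norm F G : sderiv F G -> {ae mu, forall x, `|F x| <= supb F G}.
Proof.
move=> /sobolev_sup; apply: filterS; first exact: (ae_filter_ringOfSetsType mu).
by move=> x Fx; rewrite -sqrtr_sqr ler_wsqrtr.
Qed.

Lemma l2M_sobolev F G K : sderiv F G -> (fun x => F x * K x) \in l2.
Proof.
move=> FG; have := sobolev_sup_norm FG; set c := supb F G => Fc.
have mFK : measurable_fun setT (fun x => F x * K x).
  by apply: measurable_funM; exact: measurable_L2.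
apply/l2P; split=> //; apply/integrableP; split.
  by apply/measurable_EFinP/measurable_funX.
have /integrableP[_] := integrable_L2M (c *: K) (c *: K).
apply: le_lt_trans; apply: ae_ge0_le_integral => //.
- by apply: measurableT_comp => //; apply/measurable_EFinP/measurable_funX.
- apply: measurableT_comp => //; apply/measurable_EFinP/measurable_funM; exact: measurable_L2.
move: Fc; apply: filterS; first exact: (ae_filter_ringOfSetsType mu).
move=> x Fx _; rewrite /= lee_fin normrX !normrM -expr2.
rewrite lerXn2r ?nnegrE ?mulr_ge0// ler_wpM2r//.
by rewrite (le_trans Fx)// ler_norm.
Qed.

End sobolev_sup_bound.

(** * H^1 as an algebra *)

Section H1_algebra.
Context {R : realType}.
Local Notation mu := (@lebesgue_measure R).
Local Notation ip := (@ip2 R).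
Local Notation n2 := (sinorm (@ip2 R)).
Local Notation tr := (@shift2 R).
Let ipP := @ip2P R.

(* An element of H^1(R) is stored together with its derivative. *)
Definition h1 : {pred (L2space * L2space)%type} := fun p => `[< @sderiv R p.1 p.2 >].

Lemma h1P p : reflect (sderiv p.1 p.2) (p \in h1).
Proof. exact: asboolP. Qed.

Lemma h1_submod_closed : submod_closed h1.
Proof.
split.
  apply/h1P; rewrite /sderiv.
  under eq_fun do rewrite /diffq (raddf0 (tr _)) subrr scaler0 subrr (sinorm0 ipP).
  exact: cvg_cst.
move=> a p q /h1P pd /h1P qd; apply/h1P; apply: sderivD => //; exact: sderivZ.
Qed.
HB.instance Definition _ := GRing.isSubmodClosed.Build R _ h1 h1_submod_closed.

Record H1space := H1Space { H1val :> L2space * L2space; H1valP : H1val \in h1 }.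
HB.instance Definition _ := [isSub for H1val].
HB.instance Definition _ := [Choice of H1space by <:].
HB.instance Definition _ := [SubChoice_isSubLmodule of H1space by <:].

Implicit Types a b : H1space.

Lemma H1_sderiv a : sderiv a.1 a.2.
Proof. exact/h1P/H1valP. Qed.

Definition supn a := supb a.1 a.2.

Definition mulHL a (K : L2space) := L2Space (l2M_sobolev K (H1_sderiv a)).

Lemma sinorm_mulHL a K : n2 (mulHL a K) <= supn a * n2 K.
Proof.
apply: sinorm_ip2_le; first exact: sqrtr_ge0.
have := sobolev_sup_norm (H1_sderiv a).
apply: filterS; first exact: (ae_filter_ringOfSetsType mu).
by move=> x ax; rewrite /= normrM ler_wpM2r.
Qed.

Lemma h1_shift h a : (tr h a.1, tr h a.2) \in h1.
Proof. by apply/h1P => /=; apply: sderiv_shift; exact: H1_sderiv. Qed.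

Definition shiftH h a := H1Space (h1_shift h a).

Lemma supn_shiftH h a : supn (shiftH h a) = supn a.
Proof. by rewrite /supn /supb /= !sinorm_shift2. Qed.

Lemma supn_shift_cvg a : supn (shiftH h a - a) @[h --> 0^'] --> 0.
Proof.
have c := cvgM (cvgM (cvg_cst (2 : R)) (shift2_cvg a.1)) (shift2_cvg a.2).
rewrite !mulr0 in c.
suff : supn (shiftH h a - a) @[h --> 0^'] --> Num.sqrt (0 : R) by rewrite sqrtr0.
have e h : supn (shiftH h a - a) = Num.sqrt (2 * n2 (tr h a.1 - a.1) * n2 (tr h a.2 - a.2)).
  by [].
under eq_fun do rewrite e.
have cc : 2 * n2 (tr h a.1 - a.1) * n2 (tr h a.2 - a.2) @[h --> 0^'] --> (0 : R).
  exact: c.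
apply: (@cvg_comp _ _ _ (fun h => 2 * n2 (tr h a.1 - a.1) * n2 (tr h a.2 - a.2))
  Num.sqrt _ _ _ cc).
exact: sqrt_continuous.
Qed.

(** Product rule through the discrete identity $D_h(ab)=b(\cdot+h)\,D_ha+a\,D_hb$. The error splits
    into three products, each with one factor bounded in sup norm and one in $L^2$, and one of the
    two factors tends to 0. *)
Lemma mul_sderiv a b : sderiv (mulHL a b.1) (mulHL b a.2 + mulHL a b.2).
Proof.
have ad := H1_sderiv a; have bd := H1_sderiv b.
have E h : diffq h (mulHL a b.1) - (mulHL b a.2 + mulHL a b.2) =
    mulHL (shiftH h b) (diffq h a.1 - a.2) + mulHL (shiftH h b - b) a.2
    + mulHL a (diffq h b.1 - b.2).
  apply/val_inj/funext => x; rewrite /diffq.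
  rewrite /= !(fctE, L2valB, L2valD, L2valZ) /=.
  by rewrite /GRing.scale /=; ring.
rewrite /sderiv; under eq_fun do rewrite E.
apply: (@cvg0_norm_le _ _ _ _ _ (fun h => supn b * n2 (diffq h a.1 - a.2)
  + supn (shiftH h b - b) * n2 a.2 + supn a * n2 (diffq h b.1 - b.2))).
  move=> h; rewrite ger0_norm ?sinorm_ge0//.
  apply: le_trans (sinormD ipP _ _) _; apply: lerD; last exact: sinorm_mulHL.
  apply: le_trans (sinormD ipP _ _) _; apply: lerD; last exact: sinorm_mulHL.
  by rewrite -(supn_shiftH h b); exact: sinorm_mulHL.
have c := cvgD (cvgD (cvgM (cvg_cst (supn b)) ad)
  (cvgM (supn_shift_cvg b) (cvg_cst (n2 a.2)))) (cvgM (cvg_cst (supn a)) bd).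
by rewrite !mulr0 mul0r !addr0 in c; exact: c.
Qed.

Lemma h1_mul a b : (mulHL a b.1, mulHL b a.2 + mulHL a b.2) \in h1.
Proof. by apply/h1P => /=; exact: mul_sderiv. Qed.

Definition mulH a b := H1Space (h1_mul a b).

Definition ipH a b : R := ip a.1 b.1 + ip a.2 b.2.
Local Notation nH := (sinorm ipH).

Lemma ipHP : semi_inner ipH.
Proof.
split=> [a b|a b c|k a b|a]; rewrite /ipH.
- by rewrite (sipC ipP a.1) (sipC ipP a.2).
- by rewrite !(sipDl ipP); ring.
- by rewrite !(sipZl ipP); ring.
- by rewrite addr_ge0 ?(sip_ge0 ipP).
Qed.

Lemma sinorm_fst_le a : n2 a.1 <= nH a.
Proof. by rewrite ler_wsqrtr// lerDl (sip_ge0 ipP). Qed.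

Lemma sinorm_snd_le a : n2 a.2 <= nH a.
Proof. by rewrite ler_wsqrtr// lerDr (sip_ge0 ipP). Qed.

Lemma sinorm_ipH_le a : nH a <= n2 a.1 + n2 a.2.
Proof.
rewrite -ler_sqr ?nnegrE ?addr_ge0 ?sinorm_ge0// (sqr_sinorm ipHP) /ipH.
rewrite -!(sqr_sinorm ipP) sqrrD.
have : 0 <= n2 a.1 * n2 a.2 by rewrite mulr_ge0 ?sinorm_ge0.
by move: (n2 _) (n2 _) => x y; lra.
Qed.

Lemma supn_le a : supn a <= nH a.
Proof.
rewrite ler_wsqrtr// /ipH -!(sqr_sinorm ipP).
move: (n2 _) (n2 _) => x y; have := sqr_ge0 (x - y); rewrite sqrrB; lra.
Qed.

(** The 3 counts the product itself and the two terms of its derivative. *)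
Lemma sinorm_mulH a b : nH (mulH a b) <= 3 * (nH a * nH b).
Proof.
have M x (K : L2space) y : n2 K <= y -> n2 (mulHL x K) <= nH x * y.
  move=> Ky; rewrite (le_trans (sinorm_mulHL _ _))//.
  by rewrite ler_pM ?sinorm_ge0 ?supn_le// sqrtr_ge0.
rewrite (le_trans (sinorm_ipH_le _))//=.
have h1 := M a b.1 _ (sinorm_fst_le b).
have h2 := M a b.2 _ (sinorm_snd_le b).
have h3 := M b a.2 _ (sinorm_snd_le a).
have h4 := sinormD ipP (mulHL b a.2) (mulHL a b.2).
rewrite (mulrC (nH b)) in h3.
apply: le_trans (lerD h1 (le_trans h4 (lerD h3 h2))) _.
by move: (nH a * nH b) => z; lra.
Qed.
End H1_algebra.

(** * Complex-valued functions as pairs of real ones *)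

Section complex_spaces.
Context {R : realType}.
Local Notation ip := (@ip2 R).
Local Notation n2 := (sinorm (@ip2 R)).
Local Notation nH := (sinorm (@ipH R)).
Local Notation L := (@L2space R * @L2space R)%type.
Local Notation H := (@H1space R * @H1space R)%type.
Let ipP := @ip2P R.
Implicit Types (x y : L) (f g : H).

Definition ipC x y : R := ip x.1 y.1 + ip x.2 y.2.

Lemma ipCP : semi_inner ipC.
Proof.
split=> [x y|x y z|k x y|x]; rewrite /ipC.
- by rewrite (sipC ipP x.1) (sipC ipP x.2).
- by rewrite !(sipDl ipP); ring.
- by rewrite !(sipZl ipP); ring.
- by rewrite addr_ge0 ?(sip_ge0 ipP).
Qed.

(* The pair [(a, b)] stands for [a + i b], so [JC] is multiplication by [i]. *)
Definition JC x : L := (- x.2, x.1).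
Lemma JC_is_linear : linear JC.
Proof. by move=> k x y; congr (_, _) => /=; rewrite opprD scalerN. Qed.
HB.instance Definition _ := GRing.isLinear.Build R L L _ JC JC_is_linear.

Definition TC (h : R) x : L := (shift2 h x.1, shift2 h x.2).
Lemma TC_is_linear h : linear (TC h).
Proof. by move=> k x y; congr (_, _); apply: linearP. Qed.
HB.instance Definition _ h := GRing.isLinear.Build R L L _ (TC h) (TC_is_linear h).

Definition e0C f : L := (f.1.1, f.2.1).
Lemma e0C_is_linear : linear e0C. Proof. by []. Qed.
HB.instance Definition _ := GRing.isLinear.Build R H L _ e0C e0C_is_linear.

Definition e1C f : L := (f.1.2, f.2.2).
Lemma e1C_is_linear : linear e1C. Proof. by []. Qed.
HB.instance Definition _ := GRing.isLinear.Build R H L _ e1C e1C_is_linear.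

Definition JHC f : H := (- f.2, f.1).
Lemma JHC_is_linear : linear JHC.
Proof. by move=> k x y; congr (_, _) => /=; rewrite opprD scalerN. Qed.
HB.instance Definition _ := GRing.isLinear.Build R H H _ JHC JHC_is_linear.

Lemma shiftH_is_linear (h : R) : linear (shiftH h).
Proof. by move=> k x y; apply/val_inj; congr (_, _); apply: linearP. Qed.
HB.instance Definition _ h := GRing.isLinear.Build R H1space H1space _ (shiftH h) (shiftH_is_linear h).

Definition THC (h : R) f : H := (shiftH h f.1, shiftH h f.2).
Lemma THC_is_linear h : linear (THC h).
Proof. by move=> k x y; congr (_, _); apply: linearP. Qed.
HB.instance Definition _ h := GRing.isLinear.Build R H H _ (THC h) (THC_is_linear h).

(* [Re (f conj g) k]: it is real-trilinear and [triC f f f] is [|f|^2 f]. *)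
Definition triC f g k : H :=
  let m := mulH f.1 g.1 + mulH f.2 g.2 in (mulH m k.1, mulH m k.2).

Local Notation nC := (sinorm ipC).
Definition hipC : H -> H -> R := graph_ip ipC e0C e1C.
Local Notation hnC := (sinorm hipC).
Local Notation q f g k l := (ipC (e0C (triC f g k)) (e0C l)).

Let ipHPr := @ipHP R.
Lemma hipCP : semi_inner hipC.
Proof. exact: graph_ipP ipCP. Qed.

Lemma hipCE f g : hipC f g = ipC (e0C f) (e0C g) + ipC (e1C f) (e1C g).
Proof. by []. Qed.

Lemma ipCJ x y : ipC (JC x) y = - ipC x (JC y).
Proof. by rewrite /ipC /= (sipNl ipP) (sipNr ipP) opprD opprK addrC. Qed.

Lemma JCK x : JC (JC x) = - x.
Proof. by case: x. Qed.

Lemma ipC_TC h x y : ipC (TC h x) (TC h y) = ipC x y.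
Proof. by rewrite /ipC /= !ip2_shift2. Qed.

Lemma TCK h x : TC h (TC (- h) x) = x.
Proof. by case: x => x1 x2; rewrite /TC /= !shift2K. Qed.

Lemma TC_JC h x : TC h (JC x) = JC (TC h x).
Proof. by congr (_, _); exact: (raddfN (shift2 h)). Qed.

Lemma sinorm_ipC_le x : nC x <= n2 x.1 + n2 x.2.
Proof.
rewrite -ler_sqr ?nnegrE ?addr_ge0 ?sinorm_ge0// (sqr_sinorm ipCP) /ipC.
rewrite -!(sqr_sinorm ipP) sqrrD.
have : 0 <= n2 x.1 * n2 x.2 by rewrite mulr_ge0 ?sinorm_ge0.
by move: (n2 _) (n2 _) => a b; lra.
Qed.

Lemma diffquot_leC h f : nC (TC h (e0C f) - e0C f) <= `|h| * nC (e1C f).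
Proof.
rewrite -ler_sqr ?nnegrE ?mulr_ge0 ?sinorm_ge0// exprMn !(sqr_sinorm ipCP) /ipC /=.
rewrite -!(sqr_sinorm ipP) mulrDr -!exprMn.
by apply: lerD; rewrite lerXn2r ?nnegrE ?mulr_ge0 ?sinorm_ge0//;
  apply: sderiv_lip; exact: H1_sderiv.
Qed.

Lemma diffquot_cvgC f :
  nC (h^-1 *: (TC h (e0C f) - e0C f) - e1C f) @[h --> 0^'] --> 0.
Proof.
apply: (@cvg0_norm_le _ _ _ _ _ (fun h =>
  n2 (diffq h f.1.1 - f.1.2) + n2 (diffq h f.2.1 - f.2.2))).
  by move=> h; rewrite ger0_norm ?sinorm_ge0//; exact: sinorm_ipC_le.
by have c := cvgD (H1_sderiv f.1) (H1_sderiv f.2); rewrite addr0 in c; exact: c.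
Qed.

Lemma mulHC (a b : @H1space R) : mulH a b = mulH b a.
Proof.
by apply/val_inj; congr (_, _); apply/val_inj/funext => x /=;
  rewrite ?fctE; ring.
Qed.

Lemma mulHBr (a b c : @H1space R) : mulH a (b - c) = mulH a b - mulH a c.
Proof.
by apply/val_inj; congr (_, _); apply/val_inj/funext => x /=;
  rewrite ?fctE /=; ring.
Qed.

Lemma mulHBl (a b c : @H1space R) : mulH (a - b) c = mulH a c - mulH b c.
Proof. by rewrite mulHC mulHBr !(mulHC c). Qed.

Lemma triCBl f f' g k : triC (f - f') g k = triC f g k - triC f' g k.
Proof.
by congr (_, _); rewrite /= -mulHBl; congr mulH; rewrite !mulHBl opprD addrACA.
Qed.

Lemma triCBm f g g' k : triC f (g - g') k = triC f g k - triC f g' k.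
Proof.
by congr (_, _); rewrite /= -mulHBl; congr mulH; rewrite !mulHBr opprD addrACA.
Qed.

Lemma triCBr f g k k' : triC f g (k - k') = triC f g k - triC f g k'.
Proof. by congr (_, _); rewrite /= mulHBr. Qed.

Lemma nH_le f : (nH f.1 <= hnC f) * (nH f.2 <= hnC f).
Proof.
by split; rewrite ler_wsqrtr// /ipH hipCE /ipC /=;
  have := sip_ge0 ipP f.1.1; have := sip_ge0 ipP f.1.2;
  have := sip_ge0 ipP f.2.1; have := sip_ge0 ipP f.2.2; lra.
Qed.

Lemma hnC_le f : hnC f <= nH f.1 + nH f.2.
Proof.
rewrite -ler_sqr ?nnegrE ?addr_ge0 ?sinorm_ge0// (sqr_sinorm hipCP) sqrrD.
rewrite !(sqr_sinorm ipHPr) /ipH hipCE /ipC /=.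
have : 0 <= nH f.1 * nH f.2 by rewrite mulr_ge0 ?sinorm_ge0.
by move: (nH _ * nH _) (ip _ _) (ip _ _) (ip _ _) (ip _ _) => *; lra.
Qed.

(** Each product costs a factor 3: the sum [m] of two products costs 6, and the two components of
    the result 2 * 3 * 6. *)
Lemma triC_le f g k : hnC (triC f g k) <= 36 * (hnC f * hnC g * hnC k).
Proof.
have M (a b : @H1space R) (x y : R) : nH a <= x -> nH b <= y -> nH (mulH a b) <= 3 * (x * y).
  move=> ax bY; apply: le_trans (sinorm_mulH _ _) _.
  by rewrite ler_wpM2l// ler_pM ?sinorm_ge0.
have m : nH (mulH f.1 g.1 + mulH f.2 g.2) <= 6 * (hnC f * hnC g).
  apply: le_trans (sinormD ipHPr _ _) _.
  have h1 := M _ _ _ _ (nH_le f).1 (nH_le g).1.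
  have h2 := M _ _ _ _ (nH_le f).2 (nH_le g).2.
  apply: le_trans (lerD h1 h2) _; move: (hnC f * hnC g) => z; lra.
apply: le_trans (hnC_le _) _.
apply: le_trans (lerD (M _ _ _ _ m (nH_le k).1) (M _ _ _ _ m (nH_le k).2)) _.
move: (hnC f * hnC g) (hnC k) => a b; lra.
Qed.

Lemma quarticE f g k l : q f g k l =
  \int[@lebesgue_measure R]_t ((f.1.1 t * g.1.1 t + f.2.1 t * g.2.1 t)
    * (k.1.1 t * l.1.1 t + k.2.1 t * l.2.1 t)).
Proof.
rewrite /ipC /ip2 -RintegralD//; try exact: integrable_L2M.
by apply: eq_Rintegral => t _ /=; rewrite !fctE /=; ring.
Qed.

Lemma quartic_swapr f g k l : q f g k l = q f g l k.
Proof. by rewrite !quarticE; apply: eq_Rintegral => t _; ring. Qed.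

Lemma quartic_swap_pairs f g k l : q f g k l = q k l f g.
Proof. by rewrite !quarticE; apply: eq_Rintegral => t _; ring. Qed.

Lemma quarticJ f g : q f f g (JHC g) = 0.
Proof.
rewrite quarticE; transitivity (\int[@lebesgue_measure R]_t (0 : R)).
  by apply: eq_Rintegral => t _ /=; rewrite !fctE /=; ring.
by rewrite Rintegral_cst// mul0r.
Qed.

Lemma quartic_ge0 f : 0 <= q f f f f.
Proof. by rewrite quarticE; apply: Rintegral_ge0 => t _; rewrite -expr2 sqr_ge0. Qed.

(** Each component has squared sup norm at most [2 * N * N'], hence $|f|^2\le4NN'$ almost
    everywhere; integrating against $|f|^2$ supplies the remaining factor $N^2$. *)
Lemma quartic_le f : q f f f f <= 4 * nC (e0C f) ^+ 3 * nC (e1C f).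
Proof.
have n1 : n2 f.1.1 <= nC (e0C f) by rewrite ler_wsqrtr// lerDl (sip_ge0 ipP).
have n1' : n2 f.2.1 <= nC (e0C f) by rewrite ler_wsqrtr// lerDr (sip_ge0 ipP).
have m1 : n2 f.1.2 <= nC (e1C f) by rewrite ler_wsqrtr// lerDl (sip_ge0 ipP).
have m1' : n2 f.2.2 <= nC (e1C f) by rewrite ler_wsqrtr// lerDr (sip_ge0 ipP).
set N := nC (e0C f) in n1 n1' *; set N' := nC (e1C f) in m1 m1' *.
have N0 : 0 <= N := sinorm_ge0 _ _; have N'0 : 0 <= N' := sinorm_ge0 _ _.
have sup (a : @H1space R) K : n2 a.1 <= N -> n2 a.2 <= N' ->
    n2 (mulHL a (mulHL a K)) <= 2 * N * N' * n2 K.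
  move=> aN aN'; apply: le_trans (sinorm_mulHL _ _) _.
  have s0 : 0 <= supn a by exact: sqrtr_ge0.
  apply: le_trans (ler_wpM2l s0 (sinorm_mulHL _ _)) _.
  rewrite mulrA ler_wpM2r ?sinorm_ge0// -expr2 sqr_sqrtr; last first.
    by rewrite !mulr_ge0 ?sinorm_ge0.
  by rewrite ler_pM ?mulr_ge0 ?sinorm_ge0// ler_wpM2l.
have tE K : mulHL (mulH f.1 f.1 + mulH f.2 f.2) K =
    mulHL f.1 (mulHL f.1 K) + mulHL f.2 (mulHL f.2 K).
  by apply/val_inj/funext => t /=; rewrite !fctE /=; ring.
have tl K : n2 (mulHL (mulH f.1 f.1 + mulH f.2 f.2) K) <= 4 * N * N' * n2 K.
  rewrite tE; apply: le_trans (sinormD ipP _ _) _.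
  apply: le_trans (lerD (sup _ _ n1 m1) (sup _ _ n1' m1')) _.
  by move: (N * N') (n2 K) => *; lra.
have bd K : ip (mulHL (mulH f.1 f.1 + mulH f.2 f.2) K) K <= 4 * N * N' * ip K K.
  rewrite (le_trans (ler_norm _))// (le_trans (sip_le ipP _ _))//.
  by rewrite -(sqr_sinorm ipP) expr2 mulrA ler_wpM2r ?sinorm_ge0.
have := lerD (bd f.1.1) (bd f.2.1); rewrite -mulrDr.
rewrite -/(ipC (e0C f) (e0C f)) -(sqr_sinorm ipCP) -/N => h.
apply: le_trans h _; rewrite le_eqVlt; apply/orP; left; apply/eqP; ring.
Qed.

Theorem cubic_nls_bound (nu mu : R) (u : R -> H) :
  0 < nu -> 0 <= mu ->
  (forall t : R, 0 <= t -> sicvg hipC (within `[0, +oo[ (nbhs t)) u (u t)) ->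
  (forall t : R, 0 < t -> forall f : H,
    is_derive t 1 (fun s => ipC (JC (e0C (u s))) (e0C f))
      (nu * ipC (e1C (u t)) (e1C f) - mu * q (u t) (u t) (u t) f)) ->
  forall t : R, 0 <= t -> hnC (u t) ^+ 2 <=
    2 * hnC (u 0) ^+ 2 + (mu * 4 / (2 * nu)) ^+ 2 * hnC (u 0) ^+ 6.
Proof.
move=> nu0 mu0 uc ue t t0.
apply: (nls_apriori_bound (J := JC) (T := TC) (JH := JHC) (TH := THC) (C := 36) ipCP
  ipCJ JCK ipC_TC TCK TC_JC _ _ _ _ diffquot_leC diffquot_cvgC triCBl triCBm triCBr
  triC_le quartic_swapr quartic_swap_pairs quarticJ uc ue nu0 mu0 quartic_ge0 quartic_le t0) => //.
Qed.
End complex_spaces.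

(** * Complex-valued functions and their representation by pairs *)

Section bridge.
Local Open Scope complex_scope.
Context {R : realType}.
Local Notation mu := (@lebesgue_measure R).
Local Notation ip := (@ip2 R).
Local Notation n2 := (sinorm (@ip2 R)).
Local Notation L := (@L2space R * @L2space R)%type.
Local Notation H := (@H1space R * @H1space R)%type.
Local Notation nC := (sinorm (@ipC R)).
Local Notation hipC := (@hipC R).
Local Notation hnC := (sinorm hipC).
Let ipP := @ip2P R.
Let ipCPr := @ipCP R.
Let hipCPr := @hipCP R.
Implicit Types (x y : L) (f g : R -> R[i]) (F G : H).

Definition cfun x : R -> R[i] := fun t => x.1 t +i* x.2 t.

Lemma sqr_modc (a b : R) : modc (a +i* b) ^+ 2 = a ^+ 2 + b ^+ 2.
Proof. by rewrite /modc /= sqr_sqrtr// addr_ge0 ?sqr_ge0. Qed.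

Lemma cfun_repr f : L2 f -> exists x, f = cfun x.
Proof.
move=> [mr mi fi].
have mm : measurable_fun setT (fun t => modc (f t) ^+ 2).
  rewrite (_ : (fun t => _) = (fun t => complex.Re (f t) ^+ 2 + complex.Im (f t) ^+ 2)).
    by apply: measurable_funD; exact: measurable_funX.
  by apply/funext => t; case: (f t) => a b; rewrite sqr_modc.
have ii : mu.-integrable setT (fun t => (modc (f t) ^+ 2)%:E).
  apply/integrableP; split; first exact/measurable_EFinP.
  move: fi; apply: le_lt_trans; rewrite le_eqVlt; apply/orP; left.
  by apply/eqP/eq_integral => t _; rewrite /= ger0_norm// sqr_ge0.
have lr : (fun t => complex.Re (f t)) \in l2.
  apply/l2P; split=> //; apply: le_integrable ii => //.
    exact/measurable_EFinP/measurable_funX.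
  move=> t _ /=; rewrite lee_fin !ger0_norm ?sqr_ge0//.
  by case: (f t) => a b; rewrite sqr_modc lerDl sqr_ge0.
have li : (fun t => complex.Im (f t)) \in l2.
  apply/l2P; split=> //; apply: le_integrable ii => //.
    exact/measurable_EFinP/measurable_funX.
  move=> t _ /=; rewrite lee_fin !ger0_norm ?sqr_ge0//.
  by case: (f t) => a b; rewrite sqr_modc lerDr sqr_ge0.
exists (L2Space lr, L2Space li); apply/funext => t.
by rewrite /cfun /=; case: (f t).
Qed.

Lemma L2_cfun x : L2 (cfun x).
Proof.
split; [exact: measurable_L2|exact: measurable_L2|].
have I := integrableD measurableT (integrable_L2M x.1 x.1) (integrable_L2M x.2 x.2).
move/integrableP: I => [_]; apply: le_lt_trans; rewrite le_eqVlt; apply/orP; left.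
apply/eqP/eq_integral => t _; rewrite sqr_modc /= ger0_norm//.
by rewrite addr_ge0// -expr2 sqr_ge0.
Qed.

Lemma L2inner_cfun x y : L2inner (cfun x) (cfun y) = ipC x y.
Proof.
rewrite /L2inner /cintegral /= /ipC /ip2 -RintegralD//; try exact: integrable_L2M.
by apply: eq_Rintegral => t _ /=; ring.
Qed.

Lemma integral_modc_cfun x : \int[mu]_t (modc (cfun x t) ^+ 2) = ipC x x.
Proof.
rewrite /ipC /ip2 -RintegralD//; try exact: integrable_L2M.
by apply: eq_Rintegral => t _ /=; rewrite sqr_modc; ring.
Qed.

Lemma weak_derivative_cfun x y : weak_derivative (cfun x) (cfun y) <->
  weak_derivative_L2 x.1 y.1 /\ weak_derivative_L2 x.2 y.2.
Proof.
have E (z : L) (phi : R -> R) : cintegral (fun t => cfun z t * (phi t)%:C) =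
    (\int[mu]_t (z.1 t * phi t)) +i* (\int[mu]_t (z.2 t * phi t)).
  by congr (_ +i* _); apply: eq_Rintegral => t _ /=; ring.
split=> [xy|[xy1 xy2] phi t].
  by split=> phi t; have := xy phi t; rewrite !E => -[].
by rewrite !E; congr (_ +i* _); [exact: (xy1 phi t)|exact: (xy2 phi t)].
Qed.

Lemma h1_weak (F G : @L2space R) : weak_derivative_L2 F G -> (F, G) \in h1.
Proof. by move=> FG; apply/h1P; exact: weak_sderiv. Qed.

Lemma wderivP f : H1 f -> L2 (wderiv f) /\ weak_derivative f (wderiv f).
Proof.
move=> [_ [g gP]]; rewrite /wderiv.
by case: xgetP => [h -> //|/(_ g)]; case.
Qed.

(** The stored derivative is the chosen representative [wderiv f] itself, so the second equality
    holds pointwise and can be used for rewriting. *)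
Lemma H1_repr f : H1 f -> exists F, f = cfun (e0C F) /\ wderiv f = cfun (e1C F).
Proof.
move=> fH; have [fL _] := fH; have [dL dW] := wderivP fH.
have [x fx] := cfun_repr fL; have [y dy] := cfun_repr dL.
have [w1 w2] : weak_derivative_L2 x.1 y.1 /\ weak_derivative_L2 x.2 y.2.
  by apply/weak_derivative_cfun; rewrite -fx -dy.
exists (H1Space (h1_weak w1), H1Space (h1_weak w2)).
by rewrite dy fx /e0C /e1C /= -!surjective_pairing.
Qed.

Lemma weak_derivative_e0C F : weak_derivative (cfun (e0C F)) (cfun (e1C F)).
Proof.
by apply/weak_derivative_cfun; split; apply: sderiv_weak; exact: H1_sderiv.
Qed.

Lemma H1_cfun F : H1 (cfun (e0C F)).
Proof.
split; first exact: L2_cfun.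
by exists (cfun (e1C F)); split; [exact: L2_cfun|exact: weak_derivative_e0C].
Qed.

(** Here the derivative stored in [F] is given beforehand, and the choice made by [wderiv] may
    differ from it on a null set. Only pairings are therefore compared. *)
Lemma wderiv_cfun F : exists y, wderiv (cfun (e0C F)) = cfun y /\
  forall z, ipC z y = ipC z (e1C F).
Proof.
have [dL dW] := wderivP (H1_cfun F).
have [y dy] := cfun_repr dL; exists y; split=> // z.
rewrite dy in dW; have /weak_derivative_cfun[w1 w2] := dW.
have K (a b c : @L2space R) : n2 (a - b) = 0 -> ip c a = ip c b.
  move=> ab; apply/eqP; rewrite -subr_eq0 -(sipBr ipP) -normr_le0.
  by rewrite (le_trans (sip_le ipP _ _))// ab mulr0.
rewrite /ipC (K y.1 F.1.2) ?(K y.2 F.2.2)//.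
  exact: sderiv_unique (weak_sderiv w2) (H1_sderiv _).
exact: sderiv_unique (weak_sderiv w1) (H1_sderiv _).
Qed.

Lemma H1norm_cfun F : H1norm (cfun (e0C F)) = hnC F.
Proof.
have [y [dy yE]] := wderiv_cfun F.
by rewrite /H1norm dy !integral_modc_cfun yE (sipC ipCPr y) yE.
Qed.

Lemma H1dist_cfun F G : H1dist (cfun (e0C F)) (cfun (e0C G)) = hnC (F - G).
Proof. by rewrite -H1norm_cfun. Qed.

Lemma mulI_cfun x : (fun t => 'i * cfun x t) = cfun (JC x).
Proof. by apply/funext => t; rewrite /cfun /JC /=; simpc. Qed.

Lemma cubic_cfun (k : R) F : (fun t => cubic_nonlinearity k (cfun (e0C F) t)) =
  cfun (k *: e0C (triC F F F)).
Proof.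
apply/funext => t; rewrite /cubic_nonlinearity sqr_modc /cfun /=; simpc.
by rewrite /= !fctE /GRing.scale /=; congr (_ +i* _); ring.
Qed.

End bridge.

(** * H^1 paths and orbits *)

Section nls_paths.
Local Open Scope complex_scope.
Context {R : realType}.
Local Notation mu := (@lebesgue_measure R).
Local Notation ip := (@ip2 R).
Local Notation n2 := (sinorm (@ip2 R)).
Local Notation L := (@L2space R * @L2space R)%type.
Local Notation H := (@H1space R * @H1space R)%type.
Local Notation nC := (sinorm (@ipC R)).
Local Notation hipC := (@hipC R).
Local Notation hnC := (sinorm hipC).
Let ipP := @ip2P R.
Let ipCPr := @ipCP R.
Let hipCPr := @hipCP R.
Implicit Types (f g : R -> R[i]) (F G : H).

Lemma path_repr (u : R -> R -> R[i]) : (forall t : R, 0 <= t -> H1 (u t)) ->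
  exists U : R -> H, forall t : R, 0 <= t ->
    u t = cfun (e0C (U t)) /\ wderiv (u t) = cfun (e1C (U t)).
Proof.
move=> uH; suff /choice[U UP] : forall t : R, exists F, 0 <= t ->
    u t = cfun (e0C F) /\ wderiv (u t) = cfun (e1C F) by exists U.
(* Negative times receive the junk value 0. *)
move=> t; have [t0|] := boolP (0 <= t); last by exists 0.
by have [F FP] := H1_repr (uH t t0); exists F.
Qed.

Lemma path_cvg (u : R -> R -> R[i]) (U : R -> H) :
  (forall t : R, 0 <= t -> u t = cfun (e0C (U t)) /\ wderiv (u t) = cfun (e1C (U t))) ->
  (forall t : R, 0 <= t ->
    H1dist (u s) (u t) @[s --> within `[0, +oo[ (nbhs t)] --> (0 : R)) ->
  forall t : R, 0 <= t -> sicvg hipC (within `[0, +oo[ (nbhs t)) U (U t).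
Proof.
move=> uU uc t t0; apply: (cvg_trans _ (uc t t0)); apply: near_eq_cvg.
rewrite near_withinE; near=> s; rewrite /= in_itv/= andbT => s0.
by rewrite (uU _ s0).1 (uU _ t0).1 H1dist_cfun.
Unshelve. all: by end_near. Qed.

Lemma cubic_solution_bound (nu k : R) (u0 : R -> R[i]) (u : R -> R -> R[i]) :
  0 < nu -> 0 <= k -> nls_solution nu (cubic_nonlinearity k) u0 u ->
  forall t : R, 0 <= t -> H1norm (u t) ^+ 2 <=
    2 * H1norm (u 0) ^+ 2 + (k * 4 / (2 * nu)) ^+ 2 * H1norm (u 0) ^+ 6.
Proof.
move=> nu0 k0 [uH _ uc ue] t t0.
have [U uU] := path_repr uH.
have [u0E _] : u 0 = cfun (e0C (U 0)) /\ wderiv (u 0) = cfun (e1C (U 0)).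
  exact: uU (lexx _).
rewrite u0E (uU t t0).1 !H1norm_cfun.
have D (s : R) : 0 < s -> forall F, is_derive s 1 (fun s => ipC (JC (e0C (U s))) (e0C F))
    (nu * ipC (e1C (U s)) (e1C F) - k * ipC (e0C (triC (U s) (U s) (U s))) (e0C F)).
  move=> s0 F; have := ue s s0 _ (H1_cfun F).
  rewrite (uU s (ltW s0)).2 (uU s (ltW s0)).1 cubic_cfun L2inner_cfun.
  have [y [-> yE]] := wderiv_cfun F; rewrite L2inner_cfun yE (sipZl ipCPr).
  apply: near_eq_is_derive; near=> r.
  have r0 : 0 <= r by apply: ltW; near: r; exact: lt_nbhsr.
  by rewrite (uU r r0).1 mulI_cfun L2inner_cfun.
exact: (cubic_nls_bound nu0 k0 (path_cvg uU uc) D t0).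
Unshelve. all: by end_near. Qed.

Lemma sderiv_eq0 (F G : @L2space R) : n2 F = 0 -> sderiv F G -> n2 G = 0.
Proof.
move=> F0 FG; have z : weak_derivative_L2 F 0.
  move=> phi t; rewrite -(scale0r 0) (sipZl ipP) mul0r oppr0; apply/eqP.
  by rewrite -normr_le0 (le_trans (sip_le ipP _ _))// F0 mul0r.
by rewrite -(subr0 G); exact: sderiv_unique FG (weak_sderiv z).
Qed.

(** Needed because a solution agrees with its datum only almost everywhere. Derivatives follow: a
    function of norm 0 has a derivative of norm 0. *)
Lemma H1norm_ae_eq f g : H1 f -> H1 g -> {ae mu, forall x, f x = g x} ->
  H1norm f = H1norm g.
Proof.
move=> /H1_repr[F [-> _]] /H1_repr[G [-> _]] FG; rewrite !H1norm_cfun.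
have e0 (a b : @L2space R) : {ae mu, forall x, a x = b x} -> n2 (a - b) = 0.
  move=> ab; have ae0 : ae_eq mu setT (a - b) (0 : L2space).
    move: ab; apply: filterS; first exact: (ae_filter_ringOfSetsType mu).
    by move=> x abx _; rewrite L2valB abx subrr.
  by rewrite /sinorm (ip2_ae_eq ae0 ae0) -(scale0r 0) (sipZl ipP) mul0r sqrtr0.
have z1 : n2 (F.1.1 - G.1.1) = 0.
  apply: e0; move: FG; apply: filterS; first exact: (ae_filter_ringOfSetsType mu).
  by move=> x [].
have z2 : n2 (F.2.1 - G.2.1) = 0.
  apply: e0; move: FG; apply: filterS; first exact: (ae_filter_ringOfSetsType mu).
  by move=> x [].
have z3 : n2 (F.1.2 - G.1.2) = 0 := sderiv_eq0 z1 (H1_sderiv (F.1 - G.1)).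
have z4 : n2 (F.2.2 - G.2.2) = 0 := sderiv_eq0 z2 (H1_sderiv (F.2 - G.2)).
apply/eqP; rewrite -subr_eq0 -normr_le0 (le_trans (ler_sinorm_dist hipCPr _ _))//.
rewrite /sinorm hipCE /ipC /= -!(sqr_sinorm ipP) z1 z2 z3 z4.
by rewrite expr0n /= !addr0 sqrtr0.
Qed.

Lemma modulated_cfun (theta y : R) F : (fun x => expi theta * cfun (e0C F) (x - y)) =
  cfun (e0C (cos theta *: THC (- y) F + sin theta *: JHC (THC (- y) F))).
Proof.
apply/funext => x; rewrite /expi /cfun /=; simpc.
by rewrite /= !fctE /GRing.scale /=; congr (_ +i* _); ring.
Qed.

Lemma H1norm_modulated (theta y : R) f : H1 f ->
  H1norm (fun x => expi theta * f (x - y)) = H1norm f.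
Proof.
move=> /H1_repr[F [-> _]]; rewrite modulated_cfun !H1norm_cfun.
congr Num.sqrt; set G := THC (- y) F.
have -> : hipC F F = hipC G G.
  by rewrite !hipCE -(ipC_TC (- y) (e0C F)) -(ipC_TC (- y) (e1C F)).
have J0 (x : L) : ipC x (JC x) = 0.
  by have := ipCJ x x; rewrite (sipC ipCPr); lra.
have JJ (x : L) : ipC (JC x) (JC x) = ipC x x.
  by rewrite ipCJ JCK (sipNr ipCPr) opprK.
have e (x : L) : ipC (cos theta *: x + sin theta *: JC x)
    (cos theta *: x + sin theta *: JC x) = ipC x x.
  rewrite !(sipDl ipCPr) !(sipDr ipCPr) !(sipZl ipCPr) !(sipZr ipCPr).
  rewrite (sipC ipCPr (JC x) x) J0 JJ.
  by have := cos2Dsin2 theta; move: (ipC x x) => z cs; rewrite -[RHS]mul1r -cs; ring.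
have E0 : e0C (cos theta *: G + sin theta *: JHC G) =
    cos theta *: e0C G + sin theta *: JC (e0C G) by [].
have E1 : e1C (cos theta *: G + sin theta *: JHC G) =
    cos theta *: e1C G + sin theta *: JC (e1C G) by [].
by rewrite !hipCE E0 E1 !e.
Qed.

Lemma H1dist_le f g : H1 f -> H1 g -> H1dist f g <= H1norm f + H1norm g.
Proof.
move=> /H1_repr[F [-> _]] /H1_repr[G [-> _]].
rewrite H1dist_cfun !H1norm_cfun; exact: sinormB.
Qed.

Lemma H1dist_tri f g h : H1 f -> H1 g -> H1 h ->
  H1dist f h <= H1dist f g + H1dist g h.
Proof.
move=> /H1_repr[F [-> _]] /H1_repr[G [-> _]] /H1_repr[K [-> _]].
rewrite !H1dist_cfun; exact: sinorm_triB.
Qed.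

Lemma H1norm_le_dist f g : H1 f -> H1 g -> H1norm g <= H1norm f + H1dist f g.
Proof.
move=> /H1_repr[F [-> _]] /H1_repr[G [-> _]].
rewrite H1dist_cfun !H1norm_cfun.
have := ler_sinorm_dist hipCPr F G; rewrite ler_norml => /andP[h _]; lra.
Qed.

Lemma H1_modulated (theta y : R) f : H1 f -> H1 (fun x => expi theta * f (x - y)).
Proof. by move=> /H1_repr[F [-> _]]; rewrite modulated_cfun; exact: H1_cfun. Qed.

Lemma orbit_dist_le (W v : R -> R[i]) : H1 W -> H1 v ->
  (orbit_dist W v <= (H1norm v + H1norm W)%:E)%E.
Proof.
move=> WH vH; rewrite /orbit_dist.
apply: (@le_trans _ _ (H1dist v (fun x => expi 0 * W (x - 0)))%:E).
  apply: (@le_trans _ _ (ereal_inf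
    [set (H1dist v (fun x => expi 0 * W (x - y)))%:E | y in [set: R]])).
    by apply: ereal_inf_lbound; exists 0.
  by apply: ereal_inf_lbound; exists 0.
rewrite lee_fin -(H1norm_modulated 0 0 WH); apply: H1dist_le => //.
exact: H1_modulated.
Qed.

Lemma orbit_dist_norm_le (W v : R -> R[i]) (e : R) : H1 W -> H1 v ->
  (orbit_dist W v <= e%:E)%E -> H1norm W <= H1norm v + e.
Proof.
move=> WH vH ve; apply/ler_addgt0Pr => d d0.
have : (orbit_dist W v < (e + d)%:E)%E.
  by rewrite (le_lt_trans ve)// lte_fin ltrDl.
move=> /ereal_inf_lt[_ [theta _ <-]] /ereal_inf_lt[_ [y _ <-]]; rewrite lte_fin => vd.
have := H1norm_le_dist vH (H1_modulated theta y WH); rewrite H1norm_modulated// => /le_trans; apply.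
by rewrite -addrA lerD2l ltW.
Qed.

Lemma H1norm_path_cvg0 (u : R -> R -> R[i]) : (forall t : R, 0 <= t -> H1 (u t)) ->
  (forall t : R, 0 <= t ->
    H1dist (u s) (u t) @[s --> within `[0, +oo[ (nbhs t)] --> (0 : R)) ->
  H1norm (u t) @[t --> 0^'+] --> H1norm (u 0).
Proof.
move=> uH uc; have [U uU] := path_repr uH.
have c : hnC (U s) @[s --> within `[0, +oo[ (nbhs (0 : R))] --> hnC (U 0).
  exact: (sicvg_norm hipCPr (path_cvg uU uc (lexx 0))).
rewrite (uU 0 (lexx _)).1 H1norm_cfun.
apply: (@cvg_trans _ (hnC (U s) @[s --> 0^'+])).
  apply: near_eq_cvg; near=> s.
  have s0 : 0 <= s by apply: ltW; near: s; exact: nbhs_right_gt.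
  by rewrite (uU s s0).1 H1norm_cfun.
apply: cvg_trans c; apply: cvg_app; apply: within_subset => s /= s0.
by rewrite in_itv/= ltW.
Unshelve. all: by end_near. Qed.

End nls_paths.

(** * Smallness of the profile and of the cubic solution, conclusion *)

Lemma H1norm_ge0 (R : realType) (f : R -> R[i]) : 0 <= H1norm f.
Proof. exact: sqrtr_ge0. Qed.

Lemma stable_small_norm (R : realType) (nu gamma p eps : R)
    (W U0 : R -> R[i]) (delta : R -> R) :
  orbitally_stable nu gamma p W delta -> 0 < eps -> H1 W -> H1 U0 ->
  H1dist U0 W <= delta eps -> H1norm W <= H1norm U0 + eps.
Proof.
move=> stab eps0 WH U0H dW; have [_ /(_ _ U0H dW)[U [[UH Uae Uc _] sup]]] := stab eps eps0.
rewrite -(H1norm_ae_eq (UH 0 (lexx _)) U0H Uae).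
(* The supremum in the stability property leaves out time 0, so the bound is obtained at positive
   times and passed to the limit. *)
have c0 : H1norm (U t) + eps @[t --> 0^'+] --> H1norm (U 0) + eps.
  by apply: cvgD; [exact: H1norm_path_cvg0|exact: cvg_cst].
apply: (cvgr_to_ge c0); near=> t.
have t0 : 0 < t by near: t; exact: nbhs_right_gt.
apply: orbit_dist_norm_le => //; first by apply: UH; exact: ltW.
by apply: le_trans sup; apply: ereal_sup_ubound; exists t.
Unshelve. all: by end_near. Qed.

(** As [e < 1], the sixth power of [e] is at most its square, so both terms are of order [e ^+ 2]
    and the root is linear in [e]. *)
Lemma sextic_bound (R : realType) (c e k a x : R) : 0 <= c -> 0 < e -> e < 1 ->
  0 <= a -> a <= c * e -> 0 <= x -> x ^+ 2 <= 2 * a ^+ 2 + k ^+ 2 * a ^+ 6 ->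
  x <= Num.sqrt (2 * c ^+ 2 + k ^+ 2 * c ^+ 6) * e.
Proof.
move=> c0 e0 e1 a0 ac x0 xa.
have ce0 : 0 <= c * e by rewrite mulr_ge0// ltW.
have M0 : 0 <= 2 * c ^+ 2 + k ^+ 2 * c ^+ 6.
  apply: addr_ge0; first by apply: mulr_ge0 => //; exact: sqr_ge0.
  by apply: mulr_ge0; [exact: sqr_ge0|exact: exprn_ge0].
rewrite -ler_sqr ?nnegrE ?mulr_ge0 ?sqrtr_ge0// ?(ltW e0)// exprMn sqr_sqrtr//.
have a2 : a ^+ 2 <= c ^+ 2 * e ^+ 2 by rewrite -exprMn lerXn2r.
have a6 : a ^+ 6 <= c ^+ 6 * e ^+ 2.
  apply: (@le_trans _ _ ((c * e) ^+ 6)); first by rewrite lerXn2r.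
  rewrite exprMn; apply: ler_wpM2l; first exact: exprn_ge0.
  by apply: ler_wiXn2l => //; exact: ltW.
have -> : (2 * c ^+ 2 + k ^+ 2 * c ^+ 6) * e ^+ 2 =
    2 * (c ^+ 2 * e ^+ 2) + k ^+ 2 * (c ^+ 6 * e ^+ 2) by ring.
apply: le_trans xa _; apply: lerD.
  exact: ler_wpM2l.
by apply: ler_wpM2l => //; exact: sqr_ge0.
Qed.

Theorem corollary2p1 (R : realType) (nu mu gamma p c0 c1 : R)
    (nu_gt0 : 0 < nu) (mu_gt0 : 0 < mu) (gamma_gt0 : 0 < gamma)
    (p_gt1 : 1 < p) (p_lt2 : p < 2) (c0_gt0 : 0 < c0) (c1_gt0 : 0 < c1)
    (Tf : R) (Tf_gt0 : 0 < Tf) :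
  exists K : R, 0 < K /\
    forall (omega : R) (W : R -> R[i]) (delta : R -> R),
      0 < omega ->
      standing_wave_profile nu gamma p omega W ->
      orbitally_stable nu gamma p W delta ->
    forall (eps : R) (u0 U0 : R -> R[i]),
      0 < eps -> eps < 1 ->
      H1 u0 -> H1 U0 ->
      H1dist U0 W <= delta eps ->
      H1norm u0 <= c0 * eps ->
      H1dist u0 U0 <= c1 * eps ->
      H1dist u0 W <= c1 * eps + delta eps /\
      forall u : R -> R -> R[i],
        nls_solution nu (cubic_nonlinearity mu) u0 u ->
        (ereal_sup [set orbit_dist W (u t) | t in `[0%R, Tf]] <= (K * eps)%:E)%E.
Proof.
pose M := 2 * c0 ^+ 2 + (mu * 4 / (2 * nu)) ^+ 2 * c0 ^+ 6.
(* The first summand bounds the norm of [u t] divided by [eps] at every nonnegative time, the second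
   that of [W] divided by [eps]. *)
exists (Num.sqrt M + (1 + c0 + c1)); split.
  by rewrite ltr_wpDl ?sqrtr_ge0// addr_gt0// addr_gt0.
move=> omega W delta omega0 [WH _ _] stab eps u0 U0 eps0 eps1 u0H U0H U0W u0n u0U0.
split; first by rewrite (le_trans (H1dist_tri u0H U0H WH))// lerD.
move=> u sol; have [uH uae _ _] := sol.
have u0E := H1norm_ae_eq (uH 0 (lexx _)) u0H uae.
have Wn : H1norm W <= (1 + c0 + c1) * eps.
  have h1 := stable_small_norm stab eps0 WH U0H U0W.
  have h2 := H1norm_le_dist u0H U0H.
  apply: le_trans h1 _; apply: le_trans (lerD h2 (lexx _)) _.
  have -> : (1 + c0 + c1) * eps = c0 * eps + c1 * eps + eps by ring.
  by apply: lerD (lexx _); exact: lerD.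
have un t : 0 <= t -> H1norm (u t) <= Num.sqrt M * eps.
  move=> t0; have := cubic_solution_bound nu_gt0 (ltW mu_gt0) sol t0; rewrite u0E.
  exact: (sextic_bound (ltW c0_gt0) eps0 eps1 (H1norm_ge0 u0) u0n (H1norm_ge0 _)).
apply: ge_ereal_sup => _ [t /= + <-]; rewrite in_itv/= => /andP[t0 _].
apply: le_trans (orbit_dist_le WH (uH t t0)) _.
rewrite lee_fin mulrDl; apply: lerD; [exact: un|exact: Wn].
Qed.
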